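(* In the setting of the context (a standing Lax $1$-shock), let $$\hat\eta(\tilde\xi,\lambda):=-\,\frac{\Delta(\tilde\xi,\lambda)}{\det\big(\mathcal R_+(\tilde\xi,\lambda),\,dF_1(U_-)S\big)} .$$ Assume the one-dimensional stability condition $$\mathrm{sgn}\,\det(R_+,[U])\,\det(R_+,dF_1(U_-)S)\ge0 .$$ Then nonvanishing of $\hat\Delta$ on the nonnegative half-sphere $\{|(\tilde\xi,\lambda,\eta)|=1,\ \mathrm{Re}\,\lambda\ge0,\ \eta\ge0\}$ is equivalent to the condition that the image of $\hat\eta(1,i\tau)$ over $\tau\in\mathbb R$ does not intersect the nonnegative real axis.
   Context: **Setting.** Let $x=(x_1,\tilde x)\in\mathbb R^d$, $\tilde x=(x_2,\dots,x_d)$, and consider on $\{x_1>0\}$, $t>0$ the hyperbolic–parabolic system $$\tilde U_t+\sum_jF_j(\tilde U)_{x_j}=\sum_{j,k}(B_{jk}(\tilde U)\tilde U_{x_k})_{x_j},\qquad \tilde U=(\tilde u,\tilde v)\in\mathbb R^{n-r}\times\mathbb R^r,\quad B_{jk}=\begin{pmatrix}0&0\\ b^1_{jk}&b^2_{jk}\end{pmatrix}.$$ After an invertible change of variables $\tilde U\to\tilde W=(\tilde w^1,\tilde w^2)\in\mathbb R^{n-r}\times\mathbb R^r$ it can be rewritten as $\tilde A_0(\tilde W)\tilde W_t+\sum_j\tilde A_j(\tilde W)\partial_j\tilde W-\sum_{j,k}\partial_j(\tilde B_{jk}(\tilde W)\partial_k\tilde W)=0$, $\tilde A_0$ invertible,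 $\tilde A_0=\begin{pmatrix}\tilde A_0^{11}&0\\ \tilde A_0^{21}&\tilde A_0^{22}\end{pmatrix}$, $\tilde B_{jk}=\begin{pmatrix}0&0\\0&\tilde B^{22}_{jk}\end{pmatrix}$, with Dirichlet boundary conditions for $\tilde w^1$ (full in the inflow case of (H2), none in the outflow case) and for $\tilde w^2$ (full) at $x_1=0$. $\hat U(x_1)$, $x_1\in\mathbb R$, is a stationary planar solution (standing shock) with $\hat U(\pm\infty)=U_\pm$. **Standing hypotheses** ($\sigma$ = spectrum; $\theta,\theta_1>0$ constants). (H0) $F_j,B_{jk},\tilde A_0,\tilde A_j,\tilde B_{jk},\tilde W(\cdot)$ and the boundary data are $C^s$, $s\ge2$. (H1) The eigenvalues of $\sum_j(\tilde A_0^{11})^{-1}\tilde A_j^{11}\xi_j$ are real and semisimple for all $\xi\in\mathbb R^d\setminus\{0\}$. (H2) The eigenvalues of $(\tilde A_0^{11})^{-1}\tilde A_1^{11}$ are either all $\ge\theta_1>0$ (inflow) or all $\le-\theta_1<0$ (outflow). (H3) $\mathrm{Re}\,\sigma\big(\sum_{jk}b^2_{jk}\xi_j\xi_k\big)\ge\theta|\xi|^2$ for all $\xi\in\mathbb R^d\setminus\{0\}$. (H4) The eigenvalues of $\sum_jdF_j(U_\pm)\xi_j$ are real, semisimple and of constant multiplicity with respect to $\xi\in\mathbb R^d\setminus\{0\}$. For systems that are symmetric dissipative at $U_\pm$ this may be relaxed to (H4'): about each $\xi\in\mathbb R^d\setminus\{0\}$ these eigenvalues are either of constant multiplicity or else totally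 nonglancing. (H5) The eigenvalues of $dF_1(U_\pm)$ are nonzero. (H6) $\mathrm{Re}\,\sigma\big(\sum_ji\xi_jdF_j(U_\pm)-\sum_{jk}\xi_j\xi_kB_{jk}(U_\pm)\big)\le-\theta|\xi|^2/(1+|\xi|^2)$ for all $\xi\in\mathbb R^d$. (H7), for a Lax $1$-shock: with $a_1^\pm<\dots<a_n^\pm$ the eigenvalues of $dF_1(U_\pm)$, $0<a_1^-$ and $a_1^+<0<a_2^+$, and $\hat U$ is a transversal connection from $U_-$ to $U_+$ of the standing-wave ODE $B_{11}(U)U'=F_1(U)-F_1(U_-)$. *Symmetric dissipative at $U_\pm$:* in a neighborhood of $U_\pm$ there is a smooth real matrix $\mathsf S(\tilde U)$ such that for all $\xi\in\mathbb R^d\setminus\{0\}$, $\mathsf S\tilde A_0$ is symmetric positive definite and block-diagonal, $\mathsf S\sum_j\tilde A_j\xi_j$ is symmetric, and $\mathrm{Re}\,\mathsf S\sum_{jk}\tilde B_{jk}\xi_j\xi_k$ is nonnegative with kernel of dimension $n-r$. *Totally nonglancing:* for a real root $(\tau,\xi)$ of multiplicity $m$ of $\det(\tau I+\sum_j\xi_jdF_j(U_\pm))$, with $\Delta_m$ the lowest-order (degree $m$) homogeneous part of the Taylor expansion at $(\tau,\xi)$, the conormal $dx_1$ or $-dx_1$ belongs to the connected component of $\{\Delta_m\ne0\}$ containing $dt$. **Determinants.** $[h(U)]:=h(U_+)-h(U_-)$; $S:=\lim_{z\to-\infty}\frac{\hat U'}{|\hat U'|}(z)$; the columns of $R_+$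 span the unstable subspace of $dF_1(U_+)$. For $\tilde\xi=(\xi_2,\dots,\xi_d)\in\mathbb R^{d-1}$, $\lambda\in\mathbb C$, $\mathcal R_+(\tilde\xi,\lambda)$ is a matrix block whose columns form a basis of the unstable subspace of $\mathcal A_+(\tilde\xi,\lambda):=\big(\lambda I+\sum_{j=2}^di\xi_jdF_j(U_+)\big)dF_1(U_+)^{-1}$, which may be chosen analytic in $\lambda$ for $\mathrm{Re}\,\lambda>0$ and continuous up to $\mathrm{Re}\,\lambda=0$. Set $$\Delta(\tilde\xi,\lambda):=\det\Big(\mathcal R_+(\tilde\xi,\lambda),\ \lambda[U]+\sum_{j=2}^di\xi_j[F_j(U)]\Big),$$ $$\hat\Delta(\tilde\xi,\lambda,\eta):=\det\Big(\mathcal R_+(\tilde\xi,\lambda),\ \lambda[U]+\sum_{j=2}^di\xi_j[F_j(U)]+\eta\,dF_1(U_-)S\Big),\quad\eta\in\mathbb R.$$ $\hat\eta$ is independent of the choice of $\mathcal R_+$ and homogeneous of degree one in $(\tilde\xi,\lambda)$. $\hat\eta(1,i\tau)$ denotes its value at $\tilde\xi=1$, $\lambda=i\tau$ ($\tilde\xi$ treated as a scalar, as is the case for $d=2$).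
   Formalization: Assumes also det(R_+,[U]) ≠ 0 (the equivalence can fail when it is 0) and that the denominator of η̂ is nonzero for Re λ ≥ 0, (ξ̃,λ) ≠ (0,0); the point (0,0,1) of the half-sphere, where Δ̂ is undefined, is left out. *)

(* Defs.v *)
From HB Require Import structures.
From mathcomp Require Import all_boot all_order all_algebra.
From mathcomp Require Import complex.
From mathcomp Require Import all_classical all_reals all_analysis.

Set Warnings "-redundant-canonical-projection".
Set Implicit Arguments.
Unset Strict Implicit.
Unset Printing Implicit Defensive.

Import Order.TTheory GRing.Theory Num.Theory.
Import numFieldNormedType.Exports.

Local Open Scope classical_set_scope.
Local Open Scope ring_scope.
Local Open Scope complex_scope.

(* The topology and the norm of R[i] are those of a numFieldType, as in        *)
(* numFieldNormedType, which does not apply to R[i] directly.                  *)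
HB.instance Definition _ (R : rcfType) := NormedModule.copy R[i] R[i]^o.

(* Index conventions.  The state space is R^(n1 + r), n1 = n - r, so that the  *)
(* matrix blocks 11, 12, 21, 22 are ulsubmx, ursubmx, dlsubmx, drsubmx.  The   *)
(* space dimension is q.+1: q is the number of transverse variables, ord0 the  *)
(* normal direction x_1 and lift ord0 j, j < q, the transverse direction       *)
(* x_(j+2).                                                                    *)

Section calculus.
Context {R : realType}.

Fixpoint Ck {V W : normedModType R} (k : nat) (D : set V) (f : V -> W) : Prop :=
  match k with
  | 0 => {in D, continuous f}
  | k'.+1 => (forall x, D x -> differentiable f x) /\
             (forall v : V, Ck k' D (fun x => 'D_v f x))
  end.

Definition smooth {V W : normedModType R} (D : set V) (f : V -> W) : Prop :=
  forall k, Ck k D f.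

Definition jac {n m : nat} (f : 'cV[R]_n -> 'cV[R]_m) (x : 'cV[R]_n) :
    'M[R]_(m, n) :=
  \matrix_(i, j) ('D_(delta_mx j 0) f x) i 0.

(* The norm of the library on matrices is the sup norm. *)
Definition sqnorm {m n : nat} (A : 'M[R]_(m, n)) : R :=
  \sum_i \sum_j A i j ^+ 2.
Definition enorm {m n : nat} (A : 'M[R]_(m, n)) : R := Num.sqrt (sqnorm A).

Definition analytic_at (f : R[i] -> R[i]) (z0 : R[i]) : Prop :=
  exists c : nat -> R[i], \forall z \near z0,
    series (fun k => c k * (z - z0) ^+ k) @ \oo --> f z.

End calculus.

Section spectra.
Context {R : realType}.

Definition cplx {m n : nat} (A : 'M[R]_(m, n)) : 'M[R[i]]_(m, n) :=
  map_mx (fun x : R => x%:C) A.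

Definition real_eigenvalues {n : nat} (A : 'M[R]_n) : Prop :=
  forall a : R[i], eigenvalue (cplx A) a -> complex.Im a = 0.

Definition semisimple_eigenvalue {n : nat} (A : 'M[R]_n) (a : R[i]) : Prop :=
  \rank (eigenspace (cplx A) a) = mup a (char_poly (cplx A)).

Definition real_semisimple {n : nat} (A : 'M[R]_n) : Prop :=
  real_eigenvalues A /\
  (forall a, eigenvalue (cplx A) a -> semisimple_eigenvalue A a).

(* Unstable subspace: sum of the generalized eigenspaces of the eigenvalues of *)
(* positive real part.  The transposes are there because the library's         *)
(* eigenspaces consist of row vectors.                                         *)
Definition unstable {n : nat} (M : 'M[R[i]]_n) (v : 'cV[R[i]]_n) : Prop :=
  exists s : seq R[i], all (fun a => 0 < complex.Re a) s /\
    (v^T <= \sum_(a <- s) geigenspace M^T a)%MS.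

Definition unstable_basis {n k : nat} (M : 'M[R[i]]_n) (P : 'M[R[i]]_(n, k)) :
    Prop :=
  \rank P = k /\ (forall v : 'cV_n, unstable M v <-> (v^T <= P^T)%MS).

End spectra.

Section symbols.
Context {R : realType} {d n : nat}.
Implicit Types (A : 'I_d.+1 -> 'M[R]_n) (xi : 'rV[R]_d.+1).

Definition symbol A xi : 'M[R]_n := \sum_j xi 0 j *: A j.

Definition symbol2 {r : nat} (B : 'I_d.+1 -> 'I_d.+1 -> 'M[R]_r) xi : 'M[R]_r :=
  \sum_j \sum_k (xi 0 j * xi 0 k) *: B j k.

Definition constant_multiplicity A xi (a : R[i]) : Prop :=
  forall e : R, 0 < e -> \forall xi' \near xi,
    exists2 a' : R[i], `|a' - a| < e%:C &
      mup a' (char_poly (cplx (symbol A xi'))) =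
      mup a (char_poly (cplx (symbol A xi))).

(* Coefficient of degree k in h of                                             *)
(*   det ((tau0 + h tau) I + \sum_j (xi0_j + h xi_j) A_j),                     *)
(* that is, the homogeneous part of degree k, as a function of p = (tau, xi),  *)
(* of the Taylor expansion at (tau0, xi0).                                     *)
Definition taylor_part A (tau0 : R) (xi0 : 'rV[R]_d.+1) (k : nat)
    (p : R * 'rV[R]_d.+1) : R :=
  (\det ((tau0%:P + p.1 *: 'X)%:M +
     \sum_j ((xi0 0 j)%:P + p.2 0 j *: 'X) *: map_mx polyC (A j)))`_k.

Definition conormal1 : 'rV[R]_d.+1 := delta_mx 0 ord0.

Definition totally_nonglancing A (tau0 : R) (xi0 : 'rV[R]_d.+1) : Prop :=
  forall m : nat,
    (forall k, (k < m)%N -> forall p, taylor_part A tau0 xi0 k p = 0) ->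
    (exists p, taylor_part A tau0 xi0 m p <> 0) ->
    let comp := connected_component
      [set p | taylor_part A tau0 xi0 m p <> 0] (1, 0) in
    comp (0, conormal1) \/ comp (0, - conormal1).

End symbols.

Section setting.
Context {R : realType} {q n1 r : nat}.

(* Data of the hyperbolic-parabolic problem.  States range over an open set    *)
(* states (all of R^n is allowed); umap is the inverse of the change of variables  *)
(* wmap; bdry1 and bdry2 are the data, functions of (t, x_2, ..., x_d), of the *)
(* Dirichlet conditions for w^1 and w^2 (bdry1 plays no role in the outflow    *)
(* case).                                                                      *)
Record system := System {
  states : set 'cV[R]_(n1 + r);
  flux : 'I_q.+1 -> 'cV[R]_(n1 + r) -> 'cV[R]_(n1 + r);
  visc : 'I_q.+1 -> 'I_q.+1 -> 'cV[R]_(n1 + r) -> 'M[R]_(n1 + r);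
  wmap : 'cV[R]_(n1 + r) -> 'cV[R]_(n1 + r);
  umap : 'cV[R]_(n1 + r) -> 'cV[R]_(n1 + r);
  tA0 : 'cV[R]_(n1 + r) -> 'M[R]_(n1 + r);
  tA : 'I_q.+1 -> 'cV[R]_(n1 + r) -> 'M[R]_(n1 + r);
  tB : 'I_q.+1 -> 'I_q.+1 -> 'cV[R]_(n1 + r) -> 'M[R]_(n1 + r);
  bdry1 : R * 'cV[R]_q -> 'cV[R]_n1;
  bdry2 : R * 'cV[R]_q -> 'cV[R]_r
}.

Variable sys : system.
Local Notation dom := (states sys).
Local Notation F := (flux sys).
Local Notation B := (visc sys).
Local Notation W := (wmap sys).
Local Notation Uof := (umap sys).
Local Notation At0 := (tA0 sys).
Local Notation At := (tA sys).
Local Notation Bt := (tB sys).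

Definition wdom : set 'cV[R]_(n1 + r) := W @` dom.

(* Substituting U = umap w in the conservative form of the equations gives, by  *)
(* the chain rule, the three formulas for tA0, tA and tB.                      *)
Definition structure_conditions : Prop :=
  [/\ open dom,
      open wdom,
      (forall U, dom U -> Uof (W U) = U),
      (forall j k U, dom U -> usubmx (B j k U) = 0) &
      forall w, wdom w ->
      [/\ At0 w = jac Uof w,
          (forall j, At j w = jac (F j) (Uof w) *m jac Uof w),
          (forall j k, Bt j k w = B j k (Uof w) *m jac Uof w),
          At0 w \in unitmx /\ ursubmx (At0 w) = 0 &
          forall j k, [/\ ulsubmx (Bt j k w) = 0, ursubmx (Bt j k w) = 0 &
                          dlsubmx (Bt j k w) = 0]]].

Definition positive_times : set (R * 'cV[R]_q) := [set p | 0 < p.1].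

Definition H0 (s : nat) : Prop :=
  [/\ (2 <= s)%N,
      (forall j, Ck s dom (F j)),
      (forall j k, Ck s dom (B j k)),
      Ck s dom W /\ Ck s wdom Uof &
      [/\ Ck s wdom At0,
          (forall j, Ck s wdom (At j)),
          (forall j k, Ck s wdom (Bt j k)),
          Ck s positive_times (bdry1 sys) &
          Ck s positive_times (bdry2 sys)]].

Definition A11 (j : 'I_q.+1) (w : 'cV[R]_(n1 + r)) : 'M[R]_n1 :=
  invmx (ulsubmx (At0 w)) *m ulsubmx (At j w).

Definition H1 : Prop :=
  forall w (xi : 'rV[R]_q.+1), wdom w -> xi <> 0 ->
    real_semisimple (symbol (fun j => A11 j w) xi).

(* On R[i], x <= y means that y - x is a nonnegative real number. *)
Definition H2 (theta1 : R) : Prop :=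
  (forall w a, wdom w -> eigenvalue (cplx (A11 ord0 w)) a ->
     theta1%:C <= a) \/
  (forall w a, wdom w -> eigenvalue (cplx (A11 ord0 w)) a ->
     a <= (- theta1)%:C).

Definition b2 (j k : 'I_q.+1) (U : 'cV[R]_(n1 + r)) : 'M[R]_r :=
  drsubmx (B j k U).

Definition H3 (theta : R) : Prop :=
  forall U (xi : 'rV[R]_q.+1) a, dom U -> xi <> 0 ->
    eigenvalue (cplx (symbol2 (fun j k => b2 j k U) xi)) a ->
    theta * sqnorm xi <= complex.Re a.

Definition dF (U : 'cV[R]_(n1 + r)) (j : 'I_q.+1) : 'M[R]_(n1 + r) :=
  jac (F j) U.

Definition H4 (U : 'cV[R]_(n1 + r)) : Prop :=
  forall xi : 'rV[R]_q.+1, xi <> 0 ->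
    real_semisimple (symbol (dF U) xi) /\
    forall a, eigenvalue (cplx (symbol (dF U) xi)) a ->
      constant_multiplicity (dF U) xi a.

(* tau is a root of det (tau I + \sum_j xi_j dF_j) iff - tau is an eigenvalue  *)
(* of \sum_j xi_j dF_j.                                                        *)
Definition H4' (U : 'cV[R]_(n1 + r)) : Prop :=
  forall xi : 'rV[R]_q.+1, xi <> 0 ->
    real_semisimple (symbol (dF U) xi) /\
    forall a, eigenvalue (cplx (symbol (dF U) xi)) a ->
      constant_multiplicity (dF U) xi a \/
      totally_nonglancing (dF U) (- complex.Re a) xi.

Definition quad {n : nat} (M : 'M[R]_n) (v : 'cV[R]_n) : R :=
  (v^T *m M *m v) 0 0.

Definition sympart {n : nat} (M : 'M[R]_n) : 'M[R]_n := 2^-1 *: (M + M^T).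

Definition symmetric_dissipative (U0 : 'cV[R]_(n1 + r)) : Prop :=
  exists (N : set 'cV[R]_(n1 + r))
         (Sm : 'cV[R]_(n1 + r) -> 'M[R]_(n1 + r)),
  [/\ open N, N U0, N `<=` dom, smooth N Sm &
  forall U, N U ->
    let M0 := Sm U *m At0 (W U) in
    [/\ M0^T = M0 /\ (forall v, v <> 0 -> 0 < quad M0 v),
        ursubmx M0 = 0 /\ dlsubmx M0 = 0 &
        forall xi : 'rV[R]_q.+1, xi <> 0 ->
          let M1 := Sm U *m symbol (fun j => At j (W U)) xi in
          let M2 := sympart
            (Sm U *m symbol2 (fun j k => Bt j k (W U)) xi) in
          [/\ M1^T = M1, (forall v, 0 <= quad M2 v) &
              \rank (kermx M2) = n1]]].

Definition H5 (U : 'cV[R]_(n1 + r)) : Prop :=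
  forall a, eigenvalue (cplx (dF U ord0)) a -> a != 0.

Definition H6 (theta : R) (U : 'cV[R]_(n1 + r)) : Prop :=
  forall (xi : 'rV[R]_q.+1) a,
    eigenvalue ('i *: cplx (symbol (dF U) xi)
                - cplx (symbol2 (fun j k => B j k U) xi)) a ->
    complex.Re a <= - (theta * sqnorm xi / (1 + sqnorm xi)).

Definition ordered_spectrum (M : 'M[R]_(n1 + r)) (a : 'I_(n1 + r) -> R) :
    Prop :=
  (forall i j : 'I_(n1 + r), (i < j)%N -> a i < a j) /\
  char_poly M = \prod_i ('X - (a i)%:P).

(* The case i = 0 of the hypotheses is the eigenvalue a_1. *)
Definition lax1_speeds (Up Um : 'cV[R]_(n1 + r)) : Prop :=
  exists ap am : 'I_(n1 + r) -> R,
  [/\ ordered_spectrum (dF Up ord0) ap,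
      ordered_spectrum (dF Um ord0) am,
      (forall i : 'I_(n1 + r), i = 0 :> nat -> 0 < am i),
      (forall i : 'I_(n1 + r), i = 0 :> nat -> ap i < 0) &
      (forall i : 'I_(n1 + r), i = 1 :> nat -> 0 < ap i)].

Section standing_wave.
Variables Up Um : 'cV[R]_(n1 + r).

Definition solves_at (V : R -> 'cV[R]_(n1 + r)) (z : R) : Prop :=
  [/\ dom (V z), derivable V z 1 &
      B ord0 ord0 (V z) *m 'D_1 V z = F ord0 (V z) - F ord0 Um].

(* The first n1 rows of the standing-wave equation are algebraic and define    *)
(* its phase space.                                                            *)
Definition phase_space : set 'cV[R]_(n1 + r) :=
  [set U | dom U /\ usubmx (F ord0 U) = usubmx (F ord0 Um)].

Definition unstable_manifold : set 'cV[R]_(n1 + r) :=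
  [set U | exists (V : R -> 'cV[R]_(n1 + r)) (c : R),
     [/\ 0 < c, V 0 = U, (forall z : R, z < c -> solves_at V z) &
         V @ -oo --> Um]].

Definition stable_manifold : set 'cV[R]_(n1 + r) :=
  [set U | exists (V : R -> 'cV[R]_(n1 + r)) (c : R),
     [/\ 0 < c, V 0 = U, (forall z : R, - c < z -> solves_at V z) &
         V @ +oo --> Up]].

Definition tangent (M : set 'cV[R]_(n1 + r)) (p v : 'cV[R]_(n1 + r)) : Prop :=
  exists (g : R -> 'cV[R]_(n1 + r)) (c : R),
  [/\ 0 < c, Ck 1 (ball (0 : R) c) g, (forall t, ball (0 : R) c t -> M (g t)),
      g 0 = p & 'D_1 g 0 = v].

Definition transversal_connection (Uh : R -> 'cV[R]_(n1 + r)) : Prop :=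
  [/\ (forall z, solves_at Uh z), Uh @ -oo --> Um, Uh @ +oo --> Up &
      forall z v, tangent phase_space (Uh z) v ->
        exists vm vp, [/\ tangent unstable_manifold (Uh z) vm,
                          tangent stable_manifold (Uh z) vp & v = vm + vp]].

End standing_wave.

Definition H7 (Up Um : 'cV[R]_(n1 + r)) (Uh : R -> 'cV[R]_(n1 + r)) : Prop :=
  lax1_speeds Up Um /\ transversal_connection Up Um Uh.

Definition standing_lax1_shock (s : nat) (theta theta1 : R)
    (Up Um : 'cV[R]_(n1 + r)) (Uh : R -> 'cV[R]_(n1 + r)) : Prop :=
  [/\ 0 < theta /\ 0 < theta1,
      dom Up /\ dom Um,
      structure_conditions /\ H0 s,
      [/\ H1, H2 theta1 & H3 theta] &
      [/\ (H4 Up /\ H4 Um) \/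
          [/\ symmetric_dissipative Up, symmetric_dissipative Um,
              H4' Up & H4' Um],
          H5 Up /\ H5 Um,
          H6 theta Up /\ H6 theta Um &
          H7 Up Um Uh]].

End setting.
Arguments system : clear implicits.

Section determinants.
Context {R : realType} {q n1 r : nat}.
Variable sys : system R q n1 r.
Local Notation n := (n1 + r)%N.

(* The n x n matrix (P, v): P followed by the last column v. *)
Definition augment {K : Type} {m : nat} (P : 'M[K]_(m, m.-1)) (v : 'cV[K]_m) :
    'M[K]_m :=
  \matrix_(i, j) if insub (val j) is Some k then P i k else v i 0.

Definition Aplus (Up : 'cV[R]_n) (xi : 'rV[R]_q) (lam : R[i]) : 'M[R[i]]_n :=
  (lam%:M + \sum_j ('i * (xi 0 j)%:C) *: cplx (dF sys Up (lift ord0 j)))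
  *m invmx (cplx (dF sys Up ord0)).

Definition closed_half_space : set ('rV[R]_q * R[i]) :=
  [set p | 0 <= complex.Re p.2 /\ p <> (0, 0)].

(* An admissible choice of the block R_+(xi, lam).  On Re lam = 0 its columns  *)
(* are a basis of the limit, from Re lam > 0, of the unstable subspace.        *)
(* Nothing is asked at (xi, lam) = (0, 0), where the matrix Aplus vanishes.    *)
Definition unstable_frame (Up : 'cV[R]_n)
    (Rc : 'rV[R]_q -> R[i] -> 'M[R[i]]_(n, n.-1)) : Prop :=
  [/\ (forall (xi : 'rV[R]_q) (lam : R[i]), 0 < complex.Re lam ->
         unstable_basis (Aplus Up xi lam) (Rc xi lam)),
      (forall (xi : 'rV[R]_q) (lam : R[i]), closed_half_space (xi, lam) ->
         \rank (Rc xi lam) = n.-1),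
      (forall (xi : 'rV[R]_q) (lam : R[i]) i j, 0 < complex.Re lam ->
         analytic_at (fun z => Rc xi z i j) lam) &
      {within closed_half_space,
         continuous (fun p : 'rV[R]_q * R[i] => Rc p.1 p.2)}].

Definition is_departure_direction (Uh : R -> 'cV[R]_n) (S : 'cV[R]_n) : Prop :=
  (fun z : R => (enorm ('D_1 Uh z))^-1 *: 'D_1 Uh z) @ -oo --> S.

Section fixed_shock.
Variables (Up Um S : 'cV[R]_n).
Variable Rc : 'rV[R]_q -> R[i] -> 'M[R[i]]_(n, n.-1).

Definition jump (h : 'cV[R]_n -> 'cV[R]_n) : 'cV[R]_n := h Up - h Um.

Definition dF1S : 'cV[R]_n := dF sys Um ord0 *m S.

Definition front (xi : 'rV[R]_q) (lam : R[i]) : 'cV[R[i]]_n :=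
  lam *: cplx (jump id)
  + \sum_j ('i * (xi 0 j)%:C) *: cplx (jump (flux sys (lift ord0 j))).

Definition Delta (xi : 'rV[R]_q) (lam : R[i]) : R[i] :=
  \det (augment (Rc xi lam) (front xi lam)).

Definition Delta_hat (xi : 'rV[R]_q) (lam : R[i]) (eta : R) : R[i] :=
  \det (augment (Rc xi lam) (front xi lam + eta%:C *: cplx dF1S)).

Definition eta_denominator (xi : 'rV[R]_q) (lam : R[i]) : R[i] :=
  \det (augment (Rc xi lam) (cplx dF1S)).

Definition eta_hat (xi : 'rV[R]_q) (lam : R[i]) : R[i] :=
  - (Delta xi lam / eta_denominator xi lam).

(* The point (0, 0, 1), over which Rc is not defined, is left out. *)
Definition nonvanishing_on_half_sphere : Prop :=
  forall (xi : 'rV[R]_q) (lam : R[i]) (eta : R),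
    sqnorm xi + (complex.Re lam ^+ 2 + complex.Im lam ^+ 2) + eta ^+ 2 = 1 ->
    0 <= complex.Re lam -> 0 <= eta -> (xi, lam) <> (0, 0) ->
    Delta_hat xi lam eta <> 0.

Definition nonneg_real_axis : set R[i] := [set x%:C | x in [set x : R | 0 <= x]].

Definition eta_image (xi : 'rV[R]_q) : set R[i] :=
  range (fun tau : R => eta_hat xi (tau *i)).

End fixed_shock.

Definition one_dim_stability (Up Um S : 'cV[R]_n) (Rp : 'M[R]_(n, n.-1)) :
    Prop :=
  0 <= Num.sg (\det (augment Rp (jump Up Um id)) *
               \det (augment Rp (dF1S Um S))).

End determinants.

(* Main.v *)
Require Import Defs.
From HB Require Import structures.
From mathcomp Require Import all_boot all_order all_algebra.
From mathcomp Require Import perm complex.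
From mathcomp Require Import all_classical all_reals all_analysis.
From mathcomp Require Import ring lra.

Set Implicit Arguments.
Unset Strict Implicit.
Unset Printing Implicit Defensive.

Import Order.TTheory GRing.Theory Num.Theory.
Import numFieldNormedType.Exports.
Import Normc.

Local Open Scope classical_set_scope.
Local Open Scope ring_scope.
Local Open Scope complex_scope.

(** The last column of the matrices enters their determinant linearly, so that
    Delta_hat = Delta + eta D, with D the denominator of eta_hat, nonzero on the
    closed half-space.  Nonvanishing of Delta_hat for eta >= 0 hence means that
    eta_hat takes no value in [0, +oo) on the closed half-space Re lam >= 0 minus
    the origin, and it remains to see that the points with xi = omega of norm 1 and
    lam = i tau suffice.

    Frames of the same unstable subspace differ by a change of basis, which
    multiplies Delta and D by one factor ([det_augment_basis]).  Hence eta_hat is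
    homogeneous of degree one under real scalings ([eta_scale]) and commutes with
    complex conjugation ([eta_conj]), first for Re lam > 0 and then, by continuity,
    for Re lam >= 0.  At xi = 0 the unstable subspace is that of dF1, and the
    one-dimensional stability condition gives eta_hat 0 lam = - c lam with c > 0
    ([eta_xi0], [rate_gt0]): there, no value is a nonnegative real.  By homogeneity
    one may assume |xi| = 1 elsewhere, and then eta_hat xi lam + c lam = o(|lam|)
    at infinity ([eta_growth]).

    For fixed xi, eta_hat is an analytic function of lam in the open half-plane,
    continuous up to the imaginary axis, where it avoids [0, +oo) by assumption.
    That it avoids [0, +oo) inside ([half_plane_avoid]) would follow from the
    argument principle; here the argument is a minimum modulus principle applied to
    eta_hat - eta for eta just above the largest nonnegative real value.  The
    minimum modulus principle rests on Argand's lemma: near a point where an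
    analytic function is neither zero nor locally constant, its modulus takes
    smaller values ([quotient_argand]).

    When the transverse space has dimension 1, the unit sphere is {1, -1}, and
    conjugation exchanges the two images ([eta_image_opp]). *)

(** * Determinants, frames and unstable subspaces *)

Lemma augmentE (K : Type) (k : nat) (P : 'M[K]_(k.+1, k)) (v : 'cV[K]_k.+1) i j :
  augment P v i j = if unlift ord_max j is Some l then P i l else v i 0.
Proof.
have liftE (l : 'I_k) : lift ord_max l = l :> nat.
  by rewrite /= /bump leqNgt ltn_ord.
rewrite mxE; case: unliftP => [l ->|->].
  case: insubP => [l' _ e|]; last by move: (liftE l) => /= ->; rewrite ltn_ord.
  by congr (P i _); apply/val_inj; rewrite e /= /bump leqNgt ltn_ord.
by case: insubP => // l' _ e; have := ltn_ord l'; rewrite e ltnn.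
Qed.

Lemma det_augment_linear (K : comRingType) (m : nat) (P : 'M[K]_(m, m.-1))
    (a b : K) (v w : 'cV[K]_m) : (0 < m)%N ->
  \det (augment P (a *: v + b *: w)) =
  a * \det (augment P v) + b * \det (augment P w).
Proof.
case: m P v w => // k P v w _.
rewrite !(expand_det_col _ ord_max) !mulr_sumr -big_split/=.
apply: eq_bigr => i _; rewrite !augmentE unlift_none !mxE.
(* The cofactors of the last column do not see this column. *)
suff E (x : 'cV_k.+1) :
    cofactor (augment P x) i ord_max = cofactor (augment P 0) i ord_max.
  by rewrite !(E (_ + _)) !(E v) !(E w); ring.
congr (_ * \det _); apply/matrixP => s t; rewrite !mxE/=.
by case: insubP => //=; rewrite /bump [(k <= t)%N]leqNgt (ltn_ord t)/= add0n (ltn_ord t).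
Qed.

Lemma det_augmentZ (K : comRingType) (m : nat) (P : 'M[K]_(m, m.-1)) a (v : 'cV[K]_m) :
  (0 < m)%N -> \det (augment P (a *: v)) = a * \det (augment P v).
Proof.
by move=> m0; have := det_augment_linear P a 0 v 0 m0; rewrite scale0r addr0 mul0r addr0.
Qed.

Lemma map_augment (K L : Type) (f : K -> L) (m : nat) (P : 'M[K]_(m, m.-1)) v :
  map_mx f (augment P v) = augment (map_mx f P) (map_mx f v).
Proof. by apply/matrixP => i j; rewrite !mxE; case: insub => [l|]; rewrite ?mxE. Qed.

(** Multiplying P by T on the right multiplies (P, v) on the right by the
    block-diagonal matrix diag(T, 1), whose determinant does not involve v. *)
Lemma det_augment_mulmx (K : comRingType) (m : nat) (P : 'M[K]_(m, m.-1))
    (T : 'M[K]_m.-1) : (0 < m)%N ->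
  exists t, forall v : 'cV_m, \det (augment (P *m T) v) = t * \det (augment P v).
Proof.
case: m P T => // k P T _.
pose E := \matrix_(i, j) (if unlift ord_max j is Some j' then
   if unlift ord_max i is Some i' then T i' j' else 0
   else (i == ord_max)%:R) : 'M[K]_k.+1.
exists (\det E) => v; rewrite mulrC -det_mulmx; congr (\det _).
apply/matrixP => i j; rewrite augmentE mxE (bigD1_ord ord_max)//= augmentE unlift_none.
under eq_bigr => l _ do rewrite augmentE liftK.
rewrite mxE unlift_none; case: unliftP => [l ->|->].
  rewrite mulr0 add0r mxE; apply: eq_bigr => l' _.
  by rewrite mxE !liftK.
rewrite eqxx mulr1 big1 ?addr0// => l _.
by rewrite mxE unlift_none eq_sym (negbTE (neq_lift _ _)) mulr0.
Qed.

(** Changing the basis of a hyperplane multiplies all the determinants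
    det (P, v) by one factor, so that quotients of two of them depend on the
    hyperplane only. *)
Lemma det_augment_basis (K : fieldType) (m : nat) (P P' : 'M[K]_(m, m.-1)) :
  (0 < m)%N -> (P'^T <= P^T)%MS ->
  exists t, forall v : 'cV_m, \det (augment P' v) = t * \det (augment P v).
Proof.
move=> m0 /submxP[D PD].
have -> : P' = P *m D^T by rewrite -[P']trmxK PD trmx_mul trmxK.
exact: det_augment_mulmx.
Qed.

Section Unstable.
Context {R : realType}.

Lemma unstable_sub (m : nat) (M M' : 'M[R[i]]_m) (v : 'cV[R[i]]_m) :
  (forall a : R[i], 0 < complex.Re a -> exists b : R[i], 0 < complex.Re b /\
     (geigenspace M^T a <= geigenspace M'^T b)%MS) ->
  unstable M v -> unstable M' v.
Proof.
move=> H [s [sP vs]]; elim: s v sP vs => [|a s IH] v /=.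
  by rewrite big_nil => _ vs; exists [::]; rewrite big_nil.
move=> /andP[a0 sP]; rewrite big_cons => /sub_addsmxP[[u w] /= E].
have [b [b0 ab]] := H _ a0.
have [s' [s'P ws]] := IH (w *m (\sum_(a <- s) geigenspace M^T a)%MS)^T sP
  ltac:(by rewrite trmxK submxMl).
exists (b :: s'); rewrite /= b0 s'P big_cons E; split => //.
apply: addmx_sub_adds; last by rewrite trmxK in ws.
exact: submx_trans (submxMl _ _) ab.
Qed.

(** Homogeneity of Aplus and its value at xi = 0 relate generalized eigenspaces
    one eigenvalue at a time; this is how such relations pass to bases. *)
Lemma unstable_basis_sub (m k : nat) (M M' : 'M[R[i]]_m) (P P' : 'M[R[i]]_(m, k)) :
  (forall a : R[i], 0 < complex.Re a -> exists b : R[i], 0 < complex.Re b /\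
     (geigenspace M^T a <= geigenspace M'^T b)%MS) ->
  unstable_basis M P -> unstable_basis M' P' -> (P^T <= P'^T)%MS.
Proof.
move=> H [_ MP] [_ MP']; apply/row_subP => i.
have := row_sub i P^T; rewrite -{1}[row i _]trmxK => /MP/(unstable_sub H)/MP'.
by rewrite trmxK.
Qed.

End Unstable.

Lemma geigenspace_scale (K : fieldType) (m : nat) (M : 'M[K]_m) (c a : K) :
  c != 0 -> (geigenspace M a <= geigenspace (c *: M) (c * a))%MS.
Proof.
case: m M => [|m] M c0; first by rewrite thinmx0 sub0mx.
rewrite !geigenspaceE; apply/sub_kermxP.
have -> : c *: M - (c * a)%:M = c *: (M - a%:M) by rewrite scalerBr scale_scalar_mx.
by rewrite exprZn -scalemxAr mulmx_ker scaler0.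
Qed.

(** The eigenvalues a of l M^-1 correspond to the eigenvalues l / a of M:
    M - l / a = (l M^-1 - a) (- M / a), and the two factors commute. *)
Lemma geigenspace_inv (K : fieldType) (m : nat) (M : 'M[K]_m) (l a : K) :
  M \in unitmx -> a != 0 ->
  (geigenspace (l *: invmx M) a <= geigenspace M (l / a))%MS.
Proof.
case: m M => [|m] M Mu a0; first by rewrite thinmx0 sub0mx.
rewrite !geigenspaceE; apply/sub_kermxP.
have -> : M - (l / a)%:M = (l *: invmx M - a%:M) * (- a^-1 *: M).
  rewrite -[RHS]/(_ *m _).
  rewrite -scalemxAr scaleNr mulmxBl -scalemxAl mulVmx// mul_scalar_mx.
  by rewrite scalerBr !scalerA mulVf// scale1r opprB scalemx1 mulrC.
rewrite exprMn_comm; last first.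
  rewrite /GRing.comm -[LHS]/(_ *m _) -[RHS]/(_ *m _).
  rewrite mulmxBl mulmxBr -!scalemxAr -!scalemxAl mulVmx// mulmxV//.
  by rewrite mul_scalar_mx mul_mx_scalar !scalerA [_ * a]mulrC [_ * l]mulrC.
by rewrite -[X in _ *m X]/(_ *m _) mulmxA mulmx_ker mul0mx.
Qed.

Lemma geigenspace_noneigen (K : fieldType) (m : nat) (M : 'M[K]_m) (a : K) :
  ~~ eigenvalue M a -> geigenspace M a = 0.
Proof.
case: m M => [|m] M; first by move=> _; apply/matrixP => -[].
rewrite negbK kermx_eq0 row_free_unit => Mu; rewrite geigenspaceE; apply/eqP.
by rewrite kermx_eq0 row_free_unit unitrX.
Qed.

Lemma eigenvalue_trmx (K : fieldType) m (M : 'M[K]_m) a :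
  eigenvalue M^T a = eigenvalue M a.
Proof.
rewrite !eigenvalue_root_char; congr (root _ a); rewrite /char_poly -det_tr.
by rewrite /char_poly_mx linearB/= tr_scalar_mx map_trmx trmxK.
Qed.

Section ConjBasis.
Context {R : realType}.

Lemma map_conjcK (m k : nat) (M : 'M[R[i]]_(m, k)) :
  map_mx conjc (map_mx conjc M) = M.
Proof. by apply/matrixP => i j; rewrite !mxE conjcK. Qed.

Lemma map_conj_cplx (m k : nat) (A : 'M[R]_(m, k)) :
  map_mx conjc (cplx A) = cplx A.
Proof. by apply/matrixP => i j; rewrite !mxE/= /real_complex_def oppr0. Qed.

Lemma unstable_conj (m : nat) (M : 'M[R[i]]_m) (v : 'cV[R[i]]_m) :
  unstable (map_mx conjc M) v -> unstable M (map_mx conjc v).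
Proof.
move=> [s [sP vs]]; exists (map conjc s); split.
  by apply/allP => _ /mapP[a /(allP sP) + ->]; case: a.
have : ((map_mx conjc v)^T <=
    map_mx conjc (\sum_(a <- s) geigenspace (map_mx conjc M)^T a)%MS)%MS.
  by rewrite map_trmx map_submx.
move/submx_trans; apply; elim: s {sP vs} => [|a s IH].
  have -> : map_mx (@conjc R)
      (\sum_(a <- [::]) geigenspace (map_mx conjc M)^T a)%MS = 0.
    by apply/matrixP => i j; rewrite big_nil !mxE rmorph0.
  exact: sub0mx.
rewrite /= !big_cons map_addsmx addsmxS// map_geigenspace map_trmx.
by rewrite map_conjcK.
Qed.

(** Complex conjugation maps generalized eigenspaces to generalized
    eigenspaces and preserves the sign of the real parts of eigenvalues. *)
Lemma unstable_basis_conj (m k : nat) (M : 'M[R[i]]_m) (P P' : 'M[R[i]]_(m, k)) :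
  unstable_basis M P -> unstable_basis (map_mx conjc M) P' ->
  (P'^T <= (map_mx conjc P)^T)%MS.
Proof.
move=> [_ MP] [_ MP']; apply/row_subP => i.
have := row_sub i P'^T; rewrite -{1}[row i _]trmxK => /MP'/unstable_conj/MP.
rewrite -map_trmx trmxK -(map_submx (@conjc R)) map_conjcK.
by rewrite map_trmx.
Qed.

End ConjBasis.

(** * Limits and compact sets in the complex plane *)

Section Complex.
Context {R : realType}.
Implicit Types (z w h : R[i]) (x y e : R).

Lemma normCE z : `|z| = (normc z)%:C. Proof. by []. Qed.

Lemma normc_ge0 z : 0 <= normc z.
Proof. by case: z => a b; exact: sqrtr_ge0. Qed.

Lemma ge0_complex z : 0 <= z -> exists2 x, 0 <= x & z = x%:C.
Proof. by case: z => a b; rewrite lecE/= => /andP[/eqP -> a0]; exists a. Qed.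

Lemma gt0_complex z : 0 < z -> exists2 x, 0 < x & z = x%:C.
Proof. by case: z => a b; rewrite ltcE/= => /andP[/eqP -> a0]; exists a. Qed.

Lemma normcB z w : normc (z - w) = normc (w - z).
Proof. by rewrite -opprB normcN. Qed.

Lemma normc_sqr z : normc z ^+ 2 = complex.Re z ^+ 2 + complex.Im z ^+ 2.
Proof. by case: z => a b /=; rewrite sqr_sqrtr// addr_ge0// sqr_ge0. Qed.

Lemma Re_le_normc z : `|complex.Re z| <= normc z.
Proof. by case: z => a b /=; rewrite -sqrtr_sqr ler_wsqrtr// lerDl sqr_ge0. Qed.

Lemma Im_le_normc z : `|complex.Im z| <= normc z.
Proof. by case: z => a b /=; rewrite -sqrtr_sqr ler_wsqrtr// lerDr sqr_ge0. Qed.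

Lemma normc_real x : normc x%:C = `|x|.
Proof. by rewrite /normc/= expr0n addr0 sqrtr_sqr. Qed.

Lemma nbhs_complexP z (P : set R[i]) :
  nbhs z P <-> exists2 e, 0 < e & forall w, normc (z - w) < e -> P w.
Proof.
split=> [/nbhs_normP[_ /gt0_complex[e e0 ->] eP]|[e e0 eP]].
  by exists e => // w zw; apply: eP; rewrite /= normCE ltcR.
apply/nbhs_normP; exists e%:C; first by rewrite /= ltcR.
by move=> w /=; rewrite normCE ltcR; exact: eP.
Qed.

Lemma cvg_complexP {T : Type} {F : set_system T} {FF : Filter F} (f : T -> R[i]) l :
  f @ F --> l <-> forall e, 0 < e -> \forall t \near F, normc (l - f t) < e.
Proof.
split=> [fl e e0|H].
  apply: (fl [set w | normc (l - w) < e]).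
  by apply/nbhs_complexP; exists e.
move=> P /nbhs_complexP[e e0 eP]; rewrite /fmap/=.
by apply: filterS (H e e0) => t; exact: eP.
Qed.

Lemma lipschitz_continuous_from (f : R[i] -> R) :
  (forall z w, `|f z - f w| <= normc (z - w)) -> continuous f.
Proof.
move=> fl z; apply/(@cvgrPdist_lt _ _ _ _ (nbhs_filter z)) => e e0.
apply/nbhs_complexP; exists e => // w.
exact: le_lt_trans.
Qed.

Lemma Re_continuous : continuous (@complex.Re R : R[i] -> R).
Proof.
apply: lipschitz_continuous_from => z w.
have -> : complex.Re z - complex.Re w = complex.Re (z - w) by case: z; case: w.
exact: Re_le_normc.
Qed.

Lemma Im_continuous : continuous (@complex.Im R : R[i] -> R).
Proof.
apply: lipschitz_continuous_from => z w.
have -> : complex.Im z - complex.Im w = complex.Im (z - w) by case: z; case: w.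
exact: Im_le_normc.
Qed.

Lemma dist_continuous w0 : continuous (fun z => normc (z - w0)).
Proof.
apply: lipschitz_continuous_from => z w.
have tri (a b : R[i]) : normc (a - w0) <= normc (a - b) + normc (b - w0).
  by apply: le_trans (le_normcD _ _); rewrite addrA subrK.
have := tri z w; have := tri w z; rewrite (normcB w z) ler_norml => h1 h2.
by apply/andP; split; lra.
Qed.

Lemma normc_continuous : continuous (@normc R : R[i] -> R).
Proof.
have -> : @normc R = fun z => normc (z - 0) by apply/funext => z; rewrite subr0.
exact: dist_continuous.
Qed.

Lemma complex_continuous : continuous (fun p : R * R => p.1 +i* p.2 : R[i]).
Proof.
move=> [a b]; apply/cvg_complexP => e e0.
have e2 : 0 < e / 2 by rewrite divr_gt0.
near=> p.
rewrite [X in normc X](_ : _ = (a - p.1)%:C + 'i * (b - p.2)%:C); last first.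
  by rewrite [LHS]complexE.
rewrite (le_lt_trans (le_normcD _ _))// normcM !normc_real.
have -> : normc ('i : R[i]) = 1 by rewrite /normc/= expr0n add0r expr1n sqrtr1.
rewrite mul1r (splitr e) ltrD//.
  by near: p; apply: (@cvgr_dist_lt _ _ _ _ _ fst a) => //; exact: cvg_fst.
by near: p; apply: (@cvgr_dist_lt _ _ _ _ _ snd b) => //; exact: cvg_snd.
Unshelve. all: by end_near. Qed.

Lemma closed_preimage_real (u : R[i] -> R) (D : set R) :
  continuous u -> closed D -> closed [set z | D (u z)].
Proof. by move=> uc Dc; apply: preimage_closed Dc => z _; exact: uc. Qed.

Lemma compact_disk x : compact [set z : R[i] | normc z <= x].
Proof.
have cS : compact ((fun p : R * R => p.1 +i* p.2 : R[i]) @`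
    (`[- x, x]%classic `*` `[- x, x]%classic)).
  apply: continuous_compact; first exact/continuous_subspaceT/complex_continuous.
  by apply: compact_setX; exact: segment_compact.
apply: subclosed_compact cS _.
  apply: (@closed_preimage_real (@normc R) [set y | y <= x]); last exact: closed_le.
  exact: normc_continuous.
move=> z /= zx; exists (complex.Re z, complex.Im z); last by case: z {zx}.
split => /=; rewrite in_itv/= -ler_norml.
  exact: le_trans (Re_le_normc z) zx.
exact: le_trans (Im_le_normc z) zx.
Qed.

Lemma Re_scale x z : complex.Re (x%:C * z) = x * complex.Re z.
Proof. by case: z => a b /=; rewrite mul0r subr0. Qed.

End Complex.

Section Cvg.
Context {R : realType}.

Lemma cvgC_D {T : Type} {F : set_system T} {FF : Filter F}
    (f g : T -> R[i]) (a b : R[i]) :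
  f @ F --> a -> g @ F --> b -> (fun t => f t + g t) @ F --> a + b.
Proof. exact: (@cvgD _ R[i] T F FF f g a b). Qed.

Lemma cvgC_M {T : Type} {F : set_system T} {FF : Filter F}
    (f g : T -> R[i]) (a b : R[i]) :
  f @ F --> a -> g @ F --> b -> (fun t => f t * g t) @ F --> a * b.
Proof. exact: (@cvgM R[i] T F FF f g a b). Qed.

Lemma cvgC_sum {T I : Type} {F : set_system T} {FF : Filter F} (s : seq I)
    (f : I -> T -> R[i]) (l : I -> R[i]) :
  (forall i, f i @ F --> l i) ->
  (fun t => \sum_(i <- s) f i t) @ F --> \sum_(i <- s) l i.
Proof.
move=> fl; elim: s => [|i s IH].
  by under eq_fun do rewrite big_nil; rewrite big_nil; exact: cvg_cst.
by under eq_fun do rewrite big_cons; rewrite big_cons;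
  exact: (@cvgC_D _ _ FF (f i) _ (l i) _ (fl i) IH).
Qed.

Lemma cvgC_prod {T I : Type} {F : set_system T} {FF : Filter F} (s : seq I)
    (f : I -> T -> R[i]) (l : I -> R[i]) :
  (forall i, f i @ F --> l i) ->
  (fun t => \prod_(i <- s) f i t) @ F --> \prod_(i <- s) l i.
Proof.
move=> fl; elim: s => [|i s IH].
  by under eq_fun do rewrite big_nil; rewrite big_nil; exact: cvg_cst.
by under eq_fun do rewrite big_cons; rewrite big_cons;
  exact: (@cvgC_M _ _ FF (f i) _ (l i) _ (fl i) IH).
Qed.

Lemma cvgC_det {T : Type} {F : set_system T} {FF : Filter F} (n : nat)
    (A : T -> 'M[R[i]]_n) (B : 'M[R[i]]_n) :
  (forall i j, (fun t => A t i j) @ F --> B i j) ->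
  (fun t => \det (A t)) @ F --> \det B.
Proof.
move=> AB; rewrite /determinant.
apply: (@cvgC_sum _ _ _ FF _
  (fun (s : 'S_n) t => (-1) ^+ s * \prod_i A t i (s i))
  (fun s : 'S_n => (-1) ^+ s * \prod_i B i (s i))).
move=> s; apply: (@cvgC_M _ _ FF (fun=> _)); first exact: cvg_cst.
exact: (@cvgC_prod _ _ _ FF _ (fun i t => A t i (s i))).
Qed.

Lemma within_comp {S T U : topologicalType} (f : T -> U) (h : S -> T)
    (A : set T) (B : set S) :
  {within A, continuous f} -> continuous h -> (forall x, B x -> A (h x)) ->
  {within B, continuous (f \o h)}.
Proof.
move=> /subspace_continuousP fc hc BA; apply/subspace_continuousP => x Bx.
apply: (@cvg_comp _ _ _ h f _ (within A (nbhs (h x)))); last exact: fc _ (BA _ Bx).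
move=> P wP; have hP : nbhs x (h @^-1` [set y | A y -> P y]) := hc x _ wP.
by apply: (@filterS _ _ (nbhs_filter x) _ _ _ hP) => y AP By; apply: AP; exact: BA.
Qed.

Lemma real_complex_continuous : continuous (fun x : R => x%:C).
Proof.
move=> x; apply/cvg_complexP => e e0.
near=> y; rewrite -rmorphB normc_real.
by near: y; apply: (@cvgr_dist_lt _ _ _ _ _ id x) => //; exact: cvg_id.
Unshelve. all: by end_near. Qed.

Lemma lipschitz_continuous (f : R[i] -> R[i]) :
  (forall z w, normc (f z - f w) <= normc (z - w)) -> continuous f.
Proof.
move=> fl z; apply/(@cvg_complexP _ _ _ (nbhs_filter z)) => e e0.
apply/nbhs_complexP; exists e => // w.
exact: le_lt_trans.
Qed.

Lemma conjc_continuous : continuous (@conjc R).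
Proof.
by apply: lipschitz_continuous => -[a b] [c d] /=; rewrite -opprD sqrrN.
Qed.

(** The retraction of the plane onto the closed right half-plane: composing
    with it extends a function continuous on the half-plane continuously to the
    whole plane, so that closedness and compactness need no relative topology. *)
Definition clamp (z : R[i]) : R[i] := Num.max (complex.Re z) 0 +i* complex.Im z.

Lemma clamp_id z : 0 <= complex.Re z -> clamp z = z.
Proof. by case: z => a b /= a0; rewrite /clamp/=; congr Complex; exact/max_idPl. Qed.

Lemma clamp_continuous : continuous clamp.
Proof.
apply: lipschitz_continuous => -[a b] [c d] /=.
rewrite ler_wsqrtr// lerD2r.
have [a0|a0] := leP a 0; have [c0|c0] := leP c 0.
- by rewrite subrr expr0n sqr_ge0.
- by rewrite !expr2; nra.
- by rewrite !expr2; nra.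
- exact: lexx.
Qed.

End Cvg.

Section ClosedHalfSpace.
Context {R : realType}.

Lemma right_half_closed (q : nat) (xi : 'rV[R]_q) (lam : R[i]) :
  0 < complex.Re lam -> closed_half_space (xi, lam).
Proof. by move=> l0; split => [|[_ le0]]; [exact: ltW|move: l0; rewrite le0 ltxx]. Qed.

(** The path lam + e, e -> 0+, lies in the open half-space for e > 0; along
    it both functions converge to their values at lam. *)
Lemma eq_closed_half_space (q : nat) (f g : 'rV[R]_q * R[i] -> R[i]) (xi : 'rV[R]_q) :
  {within closed_half_space, continuous f} ->
  {within closed_half_space, continuous g} ->
  (forall lam, 0 < complex.Re lam -> f (xi, lam) = g (xi, lam)) ->
  forall lam, closed_half_space (xi, lam) -> f (xi, lam) = g (xi, lam).
Proof.
move=> fc gc fg lam Ap.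
pose h (e : R) : 'rV[R]_q * R[i] := (xi, lam + e%:C).
have h0 : h 0 = (xi, lam) by rewrite /h addr0.
have hc : continuous h.
  move=> e; apply: (@cvg_pair _ _ _ _ (nbhs xi) (nbhs (lam + e%:C))).
    exact: cvg_cst.
  by apply: (@cvgC_D _ _ _ _ (fun=> lam));
    [exact: cvg_cst|exact: real_complex_continuous].
have hA (e : R) : 0 <= e -> closed_half_space (h e).
  move=> e0; case: Ap => /= Rel nz; split.
    by rewrite /=; case: (lam) Rel => a b /= a0; rewrite addr_ge0.
  move=> [xi0 le0]; apply: nz; rewrite xi0; congr pair.
  move: Rel le0; case: (lam) => a b /= a0 [/eqP ae]; rewrite addr0 => ->.
  by congr Complex; apply/eqP; move: ae; rewrite paddr_eq0// => /andP[].
have lim (u : 'rV[R]_q * R[i] -> R[i]) : {within closed_half_space, continuous u} ->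
    (u \o h) e @[e --> (0:R)^'+] --> u (xi, lam).
  move=> uc; have /subspace_continuousP/(_ 0 (lexx _)) :=
    within_comp (B := [set e : R | 0 <= e]) uc hc hA.
  rewrite -h0; apply: cvg_trans; apply: cvg_app.
  move=> P wP; have hP : nbhs (0 : R) [set e | 0 <= e -> P e] := wP.
  by apply: (@filterS _ _ (nbhs_filter (0 : R)) _ _ _ hP) => y yP y0; exact/yP/ltW.
have flim := lim f fc.
have glim : (f \o h) e @[e --> (0:R)^'+] --> g (xi, lam).
  apply: cvg_trans (lim g gc).
  apply: near_eq_cvg; near=> e; rewrite /= /h fg//.
  case: Ap => /= Rel _; case: (lam) Rel => a b /= a0.
  by rewrite ltr_wpDl//; near: e; exact: nbhs_right_gt.
exact: (@cvg_unique _ (@norm_hausdorff _ R[i]) _ _ _ _ flim glim).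
Unshelve. all: by end_near. Qed.

End ClosedHalfSpace.

(** * Analytic germs and the minimum modulus principle *)

Section Germs.
Context {K : numFieldType}.
Implicit Types (p P : {poly K}) (f g : K -> K) (M r h : K).

(** The dominating polynomial P plays the role of the norm sum |p_k| r^k; a
    polynomial divisible by X^n and bounded on the disk of radius r gains the
    factor (|h| / r)^n, with a constant that depends on P only. *)
Lemma horner_dom_tail p P r h n : 0 < r -> `|h| <= r ->
  (forall k, `|p`_k| <= P`_k) -> (forall k, (k < n)%N -> p`_k = 0) ->
  `|p.[h]| <= (`|h| / r) ^+ n * P.[r].
Proof.
move=> r0 hr pP pn; pose m := maxn (size p) (size P).
rewrite (@horner_coef_wide _ m p) ?leq_maxl// (@horner_coef_wide _ m P) ?leq_maxr//.
rewrite mulr_sumr; apply: le_trans (ler_norm_sum _ _ _) _.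
apply: ler_sum => i _; have P0 : 0 <= P`_i by exact: le_trans (pP i).
have [/pn ->|ni] := ltnP i n.
  by rewrite mul0r normr0 !mulr_ge0 ?exprn_ge0 ?divr_ge0// ltW.
have y0 : 0 <= `|h| / r by rewrite divr_ge0 ?(ltW r0).
have y1 : `|h| / r <= 1 by rewrite ler_pdivrMr ?mul1r.
have hE : `|h| ^+ i = (`|h| / r) ^+ i * r ^+ i by rewrite -exprMn divfK ?lt0r_neq0.
rewrite normrM normrX mulrCA hE ler_pM// ?mulr_ge0 ?exprn_ge0 ?(ltW r0)//.
by rewrite ler_wpM2r ?exprn_ge0 ?(ltW r0)// ler_wiXn2l.
Qed.

Lemma horner_dom p P r h : 0 < r -> `|h| <= r ->
  (forall k, `|p`_k| <= P`_k) -> `|p.[h]| <= P.[r].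
Proof.
move=> r0 hr pP; have := @horner_dom_tail _ _ _ _ 0 r0 hr pP.
by rewrite expr0 mul1r; exact.
Qed.

(** Analyticity at 0, expressed by polynomial approximation: for each N there
    is a polynomial p within O(|h|^N) of f, and both the constants and the norms
    of the p (the bounds P.[r] <= M) are uniform in N.  Since p is arbitrary
    instead of being the Taylor polynomial, the product of two approximating
    polynomials approximates the product, without truncation; since the bounds
    are uniform, a function all of whose approximating polynomials vanish to
    order N at 0 is zero near 0. *)
Definition germ_bound f M r := forall N, exists p P : {poly K},
  [/\ forall k, `|p`_k| <= P`_k, P.[r] <= M &
      forall h, `|h| <= r -> `|f h - p.[h]| <= M * (`|h| / r) ^+ N].

Definition germ f := exists M r, 0 < r /\ germ_bound f M r.

Lemma germ_bound_ge0 f M r : 0 < r -> germ_bound f M r -> 0 <= M.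
Proof.
move=> r0 /(_ 0)[p [P [pP PM _]]]; apply: le_trans PM.
by apply: le_trans (@horner_dom _ _ _ 0 r0 _ pP); rewrite ?normr0 ?(ltW r0).
Qed.

Lemma germ_bound_shrink f M r r' : 0 < r' -> r' <= r ->
  germ_bound f M r -> germ_bound f M r'.
Proof.
move=> r'0 r'r fM N; have r0 := lt_le_trans r'0 r'r.
have M0 := germ_bound_ge0 r0 fM.
have [p [P [pP PM fp]]] := fM N; exists p, P; split => // [|h hr'].
  have P0 k : 0 <= P`_k by exact: le_trans (pP k).
  apply: le_trans PM; rewrite !horner_coef; apply: ler_sum => i _.
  by rewrite ler_wpM2l// lerXn2r ?nnegrE ?(ltW r0) ?(ltW r'0).
apply: le_trans (fp _ (le_trans hr' r'r)) _.
rewrite ler_wpM2l// lerXn2r ?nnegrE ?divr_ge0// ?(ltW r0) ?(ltW r'0)//.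
by rewrite ler_wpM2l// lef_pV2 ?posrE.
Qed.

(** The radius r r' / (r + r') is below r and r', which are not compared. *)
Lemma germ_common f g : germ f -> germ g ->
  exists M M' r, [/\ 0 < r, germ_bound f M r & germ_bound g M' r].
Proof.
move=> [M [r [r0 fM]]] [M' [r' [r'0 gM]]].
have s0 : 0 < r + r' by exact: addr_gt0.
exists M, M', (r * r' / (r + r')); split; first by rewrite divr_gt0 ?mulr_gt0.
  apply: germ_bound_shrink fM; first by rewrite divr_gt0 ?mulr_gt0.
  by rewrite ler_pdivrMr// ler_pM2l// lerDr ltW.
apply: germ_bound_shrink gM; first by rewrite divr_gt0 ?mulr_gt0.
by rewrite ler_pdivrMr// mulrC ler_pM2l// lerDl ltW.
Qed.

Lemma germ_eq f g r : 0 < r -> (forall h, `|h| <= r -> f h = g h) -> germ f -> germ g.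
Proof.
move=> r0 fg [M [r' [r'0 fM]]].
have s0 : 0 < r + r' by exact: addr_gt0.
pose s := r * r' / (r + r').
have s_gt0 : 0 < s by rewrite divr_gt0 ?mulr_gt0.
have sr : s <= r by rewrite ler_pdivrMr// ler_pM2l// lerDr ltW.
have sr' : s <= r' by rewrite ler_pdivrMr// mulrC ler_pM2l// lerDl ltW.
exists M, s; split => // N.
have [p [P [pP PM fp]]] := germ_bound_shrink s_gt0 sr' fM N.
by exists p, P; split => // h hs; rewrite -fg ?fp// (le_trans hs).
Qed.

Lemma germ_cst c : germ (fun=> c).
Proof.
exists `|c|, 1; split => // N; exists c%:P, `|c|%:P; split.
- by move=> k; rewrite !coefC; case: ifP => //; rewrite normr0.
- by rewrite hornerC.
- by move=> h _; rewrite hornerC subrr normr0 mulr_ge0 ?exprn_ge0 ?divr_ge0.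
Qed.

Lemma germD f g : germ f -> germ g -> germ (fun h => f h + g h).
Proof.
move=> /germ_common/[apply] -[M [M' [r [r0 fM gM]]]].
exists (M + M'), r; split => // N.
have [p [P [pP PM fp]]] := fM N; have [q [Q [qQ QM gq]]] := gM N.
exists (p + q), (P + Q); split.
- by move=> k; rewrite !coefD (le_trans (ler_normD _ _))// lerD.
- by rewrite hornerD lerD.
- move=> h hr; rewrite hornerD opprD addrACA (le_trans (ler_normD _ _))//.
  by rewrite mulrDl lerD ?fp ?gq.
Qed.

(** f g - p q = f (g - q) + q (f - p), where |f| <= 2 M and |q| <= M'. *)
Lemma germM f g : germ f -> germ g -> germ (fun h => f h * g h).
Proof.
move=> /germ_common/[apply] -[M [M' [r [r0 fM gM]]]].
have M0 := germ_bound_ge0 r0 fM; have M'0 := germ_bound_ge0 r0 gM.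
exists (3 * (M * M')), r; split => // N.
have [p [P [pP PM fp]]] := fM N; have [q [Q [qQ QM gq]]] := gM N.
have P0 k : 0 <= P`_k by exact: le_trans (pP k).
have Q0 k : 0 <= Q`_k by exact: le_trans (qQ k).
have hornP0 (U : {poly K}) : (forall k, 0 <= U`_k) -> 0 <= U.[r].
  move=> U0; rewrite horner_coef sumr_ge0// => i _.
  by rewrite mulr_ge0 ?exprn_ge0 ?(ltW r0).
exists (p * q), (P * Q); split.
- move=> k; rewrite !coefM (le_trans (ler_norm_sum _ _ _))//.
  by apply: ler_sum => i _; rewrite normrM ler_pM.
- rewrite hornerM (le_trans (ler_pM _ _ PM QM)) ?hornP0//.
  by rewrite ler_peMl ?mulr_ge0// ler1n.
- move=> h hr; rewrite hornerM; set y := (_ / r) ^+ N.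
  have y0 : 0 <= y by rewrite exprn_ge0 ?divr_ge0 ?(ltW r0).
  have y1 : y <= 1.
    by rewrite exprn_ile1 ?divr_ge0 ?ler_pdivrMr ?mul1r ?(ltW r0).
  have nf : `|f h| <= 2 * M.
    rewrite -[f h](subrK p.[h]) (le_trans (ler_normD _ _))// mulr2n mulrDl mul1r.
    rewrite lerD ?(le_trans (horner_dom r0 hr pP))//.
    by rewrite (le_trans (fp _ hr))// ler_piMr.
  have nq : `|q.[h]| <= M' by rewrite (le_trans (horner_dom r0 hr qQ)).
  have -> : f h * g h - p.[h] * q.[h] =
      f h * (g h - q.[h]) + q.[h] * (f h - p.[h]) by ring.
  apply: le_trans (ler_normD _ _) _; rewrite !normrM.
  have -> : 3 * (M * M') * y = 2 * M * (M' * y) + M' * (M * y) by ring.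
  by rewrite lerD// ler_pM ?fp ?gq.
Qed.

Lemma germ_sum (I : Type) (s : seq I) (F : I -> K -> K) :
  (forall i, germ (F i)) -> germ (fun h => \sum_(i <- s) F i h).
Proof.
move=> gF; elim: s => [|i s IH].
  by apply: (germ_eq ltr01 _ (germ_cst 0)) => h _; rewrite big_nil.
by apply: (germ_eq ltr01 _ (germD (gF i) IH)) => h _; rewrite big_cons.
Qed.

Lemma germ_prod (I : Type) (s : seq I) (F : I -> K -> K) :
  (forall i, germ (F i)) -> germ (fun h => \prod_(i <- s) F i h).
Proof.
move=> gF; elim: s => [|i s IH].
  by apply: (germ_eq ltr01 _ (germ_cst 1)) => h _; rewrite big_nil.
by apply: (germ_eq ltr01 _ (germM (gF i) IH)) => h _; rewrite big_cons.
Qed.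

Lemma germ_det (n : nat) (A : K -> 'M[K]_n) :
  (forall i j, germ (fun h => A h i j)) -> germ (fun h => \det (A h)).
Proof.
move=> gA; apply: germ_sum => s; apply: germM; first exact: germ_cst.
by apply: germ_prod => i; exact: gA.
Qed.

(** Either some approximating polynomial of order N has a nonzero coefficient
    of degree k < N, and the least such k gives the leading term of f; or all of
    them are divisible by X^N, and f is O((|h| / r)^N) with one constant for all
    N, which forces f = 0 on smaller disks. *)
Lemma germ_dichotomy f M r : 0 < r -> germ_bound f M r ->
  (forall N h, `|h| <= r -> `|f h| <= (M + M) * (`|h| / r) ^+ N) \/
  exists k a, a != 0 /\
    forall h, `|h| <= r -> `|f h - a * h ^+ k| <= (M + M) * (`|h| / r) ^+ k.+1.
Proof.
move=> r0 fM; have M0 := germ_bound_ge0 r0 fM.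
have [E|] := pselect (exists N p P, [/\ forall k, `|p`_k| <= P`_k, P.[r] <= M,
  (forall h, `|h| <= r -> `|f h - p.[h]| <= M * (`|h| / r) ^+ N) &
  exists k, (k < N)%N && (p`_k != 0)]).
  right; have [N [p [P [pP PM fp ex]]]] := E.
  case: (ex_minnP ex) => k /andP[kN pk0] kmin; exists k, p`_k; split => // h hr.
  have y0 : 0 <= `|h| / r by rewrite divr_ge0 ?(ltW r0).
  have y1 : `|h| / r <= 1 by rewrite ler_pdivrMr ?mul1r.
  rewrite -[f h](subrK p.[h]) -addrA (le_trans (ler_normD _ _))// mulrDl lerD//.
    by rewrite (le_trans (fp _ hr))// ler_wpM2l// ler_wiXn2l.
  have -> : p.[h] - p`_k * h ^+ k = (p - p`_k *: 'X^k).[h].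
    by rewrite hornerD hornerN hornerZ hornerXn.
  apply: le_trans (@horner_dom_tail _ P r h k.+1 r0 hr _ _) _.
  - move=> j; rewrite coefB coefZ coefXn; case: eqP => [->|_].
      by rewrite mulr1 subrr normr0 (le_trans _ (pP k)).
    by rewrite mulr0 subr0.
  - move=> j; rewrite ltnS leq_eqVlt => /predU1P[->|jk].
      by rewrite coefB coefZ coefXn eqxx mulr1 subrr.
    rewrite coefB coefZ coefXn ltn_eqF// mulr0 subr0; apply/eqP; apply: contraTT jk => pj.
    rewrite -leqNgt; have [jN|Nj] := ltnP j N; first by rewrite kmin// jN pj.
    exact: leq_trans (ltnW kN) Nj.
  - by rewrite mulrC ler_wpM2r// exprn_ge0.
move=> nE; left=> N h hr.
have [p [P [pP PM fp]]] := fM N.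
rewrite -[f h](subrK p.[h]) (le_trans (ler_normD _ _))// mulrDl lerD ?fp//.
apply: le_trans (@horner_dom_tail _ P r h N r0 hr pP _) _.
  move=> k kN; apply/eqP; apply: contra_notT nE => pk.
  by exists N, p, P; split => //; exists k; rewrite kN.
by rewrite mulrC ler_wpM2r// exprn_ge0// divr_ge0// ltW.
Qed.

Lemma germ_id : germ id.
Proof.
exists 1, 1; split => // N; exists 'X, 'X; split.
- by move=> k; rewrite coefX; case: (k == 1%N); rewrite ?normr1 ?normr0.
- by rewrite hornerX.
- by move=> h _; rewrite hornerX subrr normr0 mulr_ge0 ?exprn_ge0 ?divr_ge0.
Qed.

End Germs.

Section Argand.
Context {K : numClosedFieldType}.
Implicit Types (f g : K -> K) (M r h : K).

Lemma germ_lipschitz f M r : 0 < r -> germ_bound f M r ->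
  forall h, `|h| <= r -> `|f h - f 0| <= (M + M) * (`|h| / r).
Proof.
move=> r0 /(_ 1)[p [P [pP PM fp]]] h hr.
have -> : f 0 = p.[0].
  have := fp 0; rewrite normr0 mul0r expr1 mulr0 => /(_ (ltW r0)).
  by rewrite normr_le0 subr_eq0 => /eqP.
have -> : f h - p.[0] = (f h - p.[h]) + (p - (p`_0)%:P).[h].
  by rewrite hornerD hornerN hornerC -horner_coef0; ring.
rewrite (le_trans (ler_normD _ _))// mulrDl lerD//.
  by have := fp h hr; rewrite expr1.
apply: le_trans (@horner_dom_tail _ _ P r h 1 r0 hr _ _) _.
- move=> [|k]; rewrite coefB coefC/= ?subrr ?normr0 ?subr0//.
  exact: le_trans (pP 0).
- by move=> [|//] _; rewrite coefB coefC subrr.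
- by rewrite expr1 mulrC ler_wpM2r// divr_ge0// ltW.
Qed.

(** Argand's lemma for the quotient phi / D.  If phi D(0) - phi(0) D has
    leading term a h^k, choose z with a z^k = - phi(0) D(0) and move to h = t z
    with t > 0 small: then, with an error of order t^(k+1),
    phi(h) D(0) = (1 - t^k) phi(0) D(h) + t^k phi(0) (D(h) - D(0)), and D(h) - D(0)
    is itself O(t). *)
Lemma quotient_decrease phi D M M' r a k : 0 < r ->
  germ_bound D M' r -> 0 <= M -> a != 0 -> (0 < k)%N ->
  (forall h, `|h| <= r ->
     `|phi h * D 0 - phi 0 * D h - a * h ^+ k| <= (M + M) * (`|h| / r) ^+ k.+1) ->
  phi 0 * D 0 != 0 ->
  forall d, 0 < d ->
    exists h, `|h| < d /\ `|phi h| * `|D 0| < `|phi 0| * `|D h|.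
Proof.
move=> r0 gD M0 a0 k0 psiE; set w := phi 0 * D 0 => w0 d d0.
have M'0 := germ_bound_ge0 r0 gD.
pose z := k.-root (- w / a); have zk : z ^+ k = - w / a by rewrite rootCK.
pose Z := `|z|; pose W := `|w|; have W0 : 0 < W by rewrite normr_gt0.
have Z0 : 0 <= Z by exact: normr_ge0.
pose E1 := (M + M) * (Z / r) ^+ k.+1.
pose E2 := `|phi 0| * ((M' + M') * (Z / r)).
have Zr0 : 0 <= Z / r by rewrite divr_ge0// ltW.
have E10 : 0 <= E1 by rewrite mulr_ge0 ?addr_ge0 ?exprn_ge0.
have E20 : 0 <= E2 by rewrite mulr_ge0// mulr_ge0// addr_ge0.
pose E := E1 + E2; have E0 : 0 <= E by rewrite addr_ge0.
have EW0 : 0 <= (E + E) / W by rewrite divr_ge0 ?addr_ge0// ltW.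
have Zd0 : 0 <= Z / d by rewrite divr_ge0// ltW.
(* One scale t that makes t <= 1, t Z <= r, t Z < d and 2 t E < W at once. *)
pose T := 1 + Z / r + Z / d + (E + E) / W.
have T1 : 1 <= T by rewrite /T !ler_wpDr.
have T0 : 0 < T by exact: lt_le_trans ltr01 T1.
pose t := T^-1; have t0 : 0 < t by rewrite invr_gt0.
have t1 : t <= 1 by rewrite invf_le1.
have small y c : 0 < c -> y / c < T -> t * y < c.
  by move=> c0 yT; rewrite mulrC ltr_pdivrMr// mulrC -ltr_pdivrMr.
have tZr : t * Z <= r.
  by rewrite ltW// small// /T 2?ltr_wpDr// ltrDr.
have tZd : t * Z < d.
  by rewrite small// /T ltr_wpDr// ltrDr ltr_wpDr.
have tEW : t * (E + E) < W.
  by rewrite small// /T ltrDr !ltr_wpDr.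
pose h := t * z.
have nh : `|h| = t * Z by rewrite normrM gtr0_norm.
have hr : `|h| <= r by rewrite nh.
exists h; split; first by rewrite nh.
have tk0 : 0 < t ^+ k by rewrite exprn_gt0.
have tk1 : t ^+ k <= 1 by rewrite exprn_ile1// ltW.
pose X := `|phi 0 * D h|.
have DE : `|phi 0 * (D h - D 0)| <= t * E2.
  rewrite normrM /E2 mulrCA ler_wpM2l//.
  by rewrite (le_trans (germ_lipschitz r0 gD hr))// nh -mulrA mulrCA.
have XW : W <= X + t * E2.
  rewrite /W /w (_ : _ * _ = phi 0 * D h - phi 0 * (D h - D 0)); last by ring.
  by rewrite (le_trans (ler_normB _ _))// lerD2l.
have EX : t * E < X.
  rewrite -(ltrD2r (t * E2)) (lt_le_trans _ XW)// (le_lt_trans _ tEW)//.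
  by rewrite [t * (E + E)]mulrDr lerD2l ler_pM2l// lerDr.
have rhoE : `|phi h * D 0 - phi 0 * D h - a * h ^+ k| <= t ^+ k * (t * E1).
  apply: le_trans (psiE h hr) _.
  suff -> : (M + M) * (`|h| / r) ^+ k.+1 = t ^+ k * (t * E1) by [].
  by rewrite nh -(mulrA t) exprMn (exprSr t) /E1; ring.
have hk : a * h ^+ k = - (t ^+ k * w).
  by rewrite /h exprMn zk; field.
rewrite -!normrM -/X.
have -> : phi h * D 0 = (1 - t ^+ k) * (phi 0 * D h)
    + (t ^+ k * (phi 0 * (D h - D 0)) + (phi h * D 0 - phi 0 * D h - a * h ^+ k)).
  by rewrite hk /w; ring.
have -> : X = (1 - t ^+ k) * X + t ^+ k * X by ring.
rewrite (le_lt_trans (ler_normD _ _))//.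
rewrite normrM ger0_norm ?subr_ge0// ltrD2l (le_lt_trans (ler_normD _ _))//.
rewrite normrM (ger0_norm (ltW tk0)).
apply: (@le_lt_trans _ _ (t ^+ k * (t * E))); last by rewrite ltr_pM2l.
have -> : t ^+ k * (t * E) = t ^+ k * (t * E2) + t ^+ k * (t * E1).
  by rewrite /E; ring.
by rewrite lerD// ler_wpM2l// ltW.
Qed.

End Argand.

Lemma geometric_half (K : numFieldType) n :
  \sum_(0 <= k < n) (2^-1 : K) ^+ k <= 2.
Proof.
have -> : \sum_(0 <= k < n) (2^-1 : K) ^+ k = 2 - 2 * 2^-1 ^+ n.
  elim: n => [|n IH]; first by rewrite big_nil expr0 mulr1 subrr.
  by rewrite big_nat_recr//= IH exprS; field.
by rewrite gerBl mulr_ge0// exprn_ge0// invr_ge0.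
Qed.

Section Analytic.
Context {R : realType}.
Implicit Types (z w h : R[i]) (x y e : R).

(** At radius s inside the disk of convergence the terms |c_k| s^k are
    bounded by some B; at radius s / 2 they are bounded by B 2^-k, whose sum is at
    most 2 B, and the partial sums are the approximating polynomials. *)
Lemma analytic_germ (f : R[i] -> R[i]) z :
  analytic_at f z -> germ (fun h => f (z + h)).
Proof.
move=> [c /nbhs_complexP[rho rho0 cf]].
have {}cf h : normc h < rho -> series (fun k => c k * h ^+ k) @ \oo --> f (z + h).
  move=> hr; have := cf (z + h); rewrite opprD addrA subrr add0r normcN addrC addKr.
  exact.
pose s : R[i] := (rho / 2)%:C; pose r := s / 2.
have s0 : 0 < s by rewrite ltcR divr_gt0.
have r0 : 0 < r by rewrite divr_gt0.
have [B cB] : exists B, forall k, `|c k| * s ^+ k <= B.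
  have sr : normc s < rho.
    by rewrite normc_real gtr0_norm ?divr_gt0// ltr_pdivrMr// ltr_pMr// ltr1n.
  have /cvg_complexP/(_ 1 ltr01)[m _ mP] := cf s sr.
  exists (2 + \sum_(0 <= k < m) `|c k| * s ^+ k) => k.
  have pos j : 0 <= `|c j| * s ^+ j by rewrite mulr_ge0// exprn_ge0// ltW.
  have [km|mk] := ltnP k m.
    rewrite (big_rem k) ?mem_index_iota//= addrCA lerDl addr_ge0// sumr_ge0//.
  rewrite -[leLHS]addr0 lerD ?sumr_ge0//.
  have -> : `|c k| * s ^+ k = `|c k * s ^+ k|.
    by rewrite normrM (ger0_norm (exprn_ge0 _ (ltW s0))).
  set u := fun k => c k * s ^+ k.
  have -> : c k * s ^+ k = (f (z + s) - series u k) - (f (z + s) - series u k.+1).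
    rewrite -[LHS]/(u k).
    by rewrite /series/= big_nat_recr//=; ring.
  rewrite (le_trans (ler_normB _ _))// mulr2n lerD// normCE lecR ltW//.
    exact: mP.
  by apply: mP; exact: leq_trans mk _.
have B0 : 0 <= B by apply: le_trans (cB 0); rewrite mulr_ge0.
exists (B * 2), r; split => // N.
exists (\poly_(k < N) c k), (\poly_(k < N) `|c k|); split.
- by move=> k; rewrite !coef_poly; case: ifP => _ //; rewrite normr0.
- rewrite horner_poly -(big_mkord xpredT (fun k => `|c k| * r ^+ k)).
  apply: le_trans (_ : B * \sum_(0 <= k < N) 2^-1 ^+ k <= _); last first.
    by rewrite ler_wpM2l// geometric_half.
  rewrite mulr_sumr; apply: ler_sum => k _.
  by rewrite /r exprMn mulrA ler_wpM2r// exprn_ge0// invr_ge0.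
move=> h hr; set y := `|h| / r.
have y0 : 0 <= y by rewrite divr_ge0// ltW.
have y1 : y <= 1 by rewrite ler_pdivrMr// mul1r.
have hrho : normc h < rho.
  rewrite -ltcR -normCE (le_lt_trans hr)// /r /s.
  rewrite (_ : 2 = (2 : R)%:C); last by rewrite rmorph_nat.
  by rewrite -fmorphV -rmorphM ltcR; move: rho0; lra.
(* The tail is bounded through a partial sum that is e-close to f (z + h). *)
apply/ler_addgt0Pr => _ /gt0_complex[e e0 ->].
have /cvg_complexP/(_ e e0)[m _ mP] := cf h hrho.
pose n := maxn m N.
set u := fun k => c k * h ^+ k in mP.
have -> : (\poly_(k < N) c k).[h] = series u N.
  by rewrite horner_poly /series/= big_mkord.
have -> : f (z + h) - series u N = (series u n - series u N) + (f (z + h) - series u n).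
  by ring.
rewrite (le_trans (ler_normD _ _))// lerD//.
  rewrite sub_series_geq ?leq_maxr// (le_trans (ler_norm_sum _ _ _))//.
  apply: le_trans (_ : \sum_(N <= k < n) (B * y ^+ N) * 2^-1 ^+ k <= _).
    rewrite big_nat_cond [leRHS]big_nat_cond; apply: ler_sum => k /andP[/andP[Nk _] _].
    have -> : `|u k| = (`|c k| * s ^+ k) * (y ^+ k * 2^-1 ^+ k).
      rewrite normrM normrX -mulrA -!exprMn /y /r; congr (_ * _ ^+ k).
      by field; rewrite fmorph_eq0 gt_eqF.
    rewrite -(mulrA B) ler_pM ?mulr_ge0 ?exprn_ge0 ?invr_ge0// ?(ltW s0)//.
    by rewrite ler_wpM2r ?exprn_ge0 ?invr_ge0// ler_wiXn2l.
  rewrite -mulr_sumr (mulrAC B 2) ler_wpM2l ?mulr_ge0 ?exprn_ge0//.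
  apply: le_trans (geometric_half _ n).
  by rewrite (big_cat_nat (leq0n N) (leq_maxr m N))/= lerDr sumr_ge0.
by rewrite normCE lecR ltW// mP//= leq_maxl.
Qed.

Lemma geometric_vanish (a b : R[i]) :
  0 <= a -> 0 <= b -> (forall N, a <= b * 2^-1 ^+ N) -> a = 0.
Proof.
move=> /ge0_complex[x x0 ->] /ge0_complex[y y0 ->] xy.
have {}xy N : x * 2 ^+ N <= y.
  have := xy N; rewrite (_ : 2 = (2 : R)%:C); last by rewrite rmorph_nat.
  rewrite -fmorphV -rmorphXn -rmorphM lecR exprVn => h.
  by rewrite -ler_pdivlMr// exprn_gt0.
congr (_%:C); apply/eqP; rewrite eq_le x0 andbT leNgt; apply/negP => xgt0.
have := archi_boundP (divr_ge0 y0 x0); rewrite ltr_pdivrMr// => H.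
have := xy (Num.bound (y / x)); apply/negP; rewrite -ltNge (lt_trans H)//.
by rewrite mulrC ltr_pM2l// -natrX ltr_nat ltn_expl.
Qed.

(** The modulus of phi / D can be decreased arbitrarily near a point where it
    is nonzero, unless phi / D is constant near this point.  Working with phi and
    D separately avoids power series of quotients. *)
Lemma quotient_argand (phi D : R[i] -> R[i]) :
  germ phi -> germ D -> phi 0 != 0 -> D 0 != 0 ->
  (exists2 e : R, 0 < e & forall h, normc h < e -> phi h * D 0 = phi 0 * D h) \/
  (forall e : R, 0 < e -> exists2 h, normc h < e &
     normc (phi h) * normc (D 0) < normc (phi 0) * normc (D h)).
Proof.
move=> gphi gD phi0 D0.
pose psi h := phi h * D 0 + (- phi 0) * D h.
have gpsi : germ psi.
  apply: germD; apply: germM.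
  - exact: gphi.
  - exact: germ_cst.
  - exact: germ_cst.
  - exact: gD.
have [M [M' [r [r0 psiM DM]]]] := germ_common gpsi gD.
have M0 := germ_bound_ge0 r0 psiM.
have psi0 : psi 0 = 0 by rewrite /psi; ring.
have [vanish|[k [a [a0 psiE]]]] := germ_dichotomy r0 psiM.
  left; have [s s0 rs] := gt0_complex r0.
  exists (s / 2); first by rewrite divr_gt0.
  move=> h hs; suff /eqP : psi h = 0.
    by rewrite /psi mulNr subr_eq0 => /eqP.
  have hr2 : `|h| <= r / 2.
    rewrite rs (_ : 2 = (2 : R)%:C); last by rewrite rmorph_nat.
    by rewrite -fmorphV -rmorphM normCE lecR ltW.
  have hr : `|h| <= r by rewrite (le_trans hr2)// ler_pdivrMr// ler_pMr// ler1n.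
  apply/normr0_eq0; apply: (@geometric_vanish _ (M + M)) => //.
    exact: addr_ge0.
  move=> N; apply: le_trans (vanish N h hr) _.
  rewrite ler_wpM2l ?addr_ge0// lerXn2r ?nnegrE ?divr_ge0 ?invr_ge0 ?(ltW r0)//.
  by rewrite ler_pdivrMr// mulrC.
right=> e e0.
(* psi vanishes at 0, so that its leading term is not constant. *)
have k0 : (0 < k)%N.
  case: k psiE => // /(_ 0); rewrite psi0 expr0 mulr1 sub0r normrN normr0 mul0r.
  by rewrite expr1 mulr0 => /(_ (ltW r0)); rewrite normr_le0 (negbTE a0).
have e0' : 0 < e%:C by rewrite ltcR.
have [|h [he hlt]] := @quotient_decrease _ phi D M M' r a k r0 DM M0 a0 k0 _
    (mulf_neq0 phi0 D0) _ e0'.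
  by move=> h hr; have := psiE h hr; rewrite /psi mulNr.
exists h; first by rewrite -ltcR.
by rewrite -ltcR !rmorphM.
Qed.

End Analytic.

(** * Values avoided on a half-plane *)

Section HalfPlane.
Context {R : realType}.
Implicit Types (z w h : R[i]) (x y e : R).

(** A substitute for the argument principle.  Suppose that g takes a value in
    [0, +oo) on the half-plane.  As g z is close to - c z at infinity, these values
    form a compact set; let eta1, attained at z1, be the largest.  For eta slightly
    larger than eta1, the function |g - eta| does not vanish, is small at z1, and is
    not small at infinity nor on the imaginary axis.  Its minimum is therefore
    attained inside the half-plane, at a point where |g - eta| cannot decrease, and
    near which g is therefore constant.  This is absurd at a minimiser of largest
    real part. *)
Lemma half_plane_avoid (g : R[i] -> R[i]) (c R0 : R) :
  continuous g -> 0 < c -> 0 < R0 ->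
  (forall z, 0 <= complex.Re z -> R0 <= normc z ->
     normc (g z + c%:C * z) <= c / 4 * normc z) ->
  (forall tau eta : R, 0 <= eta -> g (tau *i) <> eta%:C) ->
  (forall z w, 0 < complex.Re z -> g z <> w ->
     (exists2 e, 0 < e & forall h, normc h < e -> g (z + h) = g z) \/
     (forall e, 0 < e -> exists2 h, normc h < e &
        normc (g (z + h) - w) < normc (g z - w))) ->
  forall z (eta : R), 0 <= complex.Re z -> 0 <= eta -> g z <> eta%:C.
Proof.
move=> gc c0 R00 ginf gbd gopen.
(* |eta + c z| >= c |z| when Re z and eta are nonnegative. *)
have far z eta : 0 <= complex.Re z -> R0 <= normc z -> 0 <= eta ->
    3 / 4 * c * R0 <= normc (g z - eta%:C).
  move=> z0 zR eta0; have ez : c * normc z <= normc (eta%:C + c%:C * z).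
    rewrite -(ler_pXn2r (n := 2))// ?nnegrE ?mulr_ge0 ?normc_ge0 ?(ltW c0)//.
    rewrite exprMn !normc_sqr; case: z z0 {zR} => a b /= a0.
    rewrite !mul0r subr0 add0r addr0 mulrDr -!exprMn lerD2r.
    by rewrite ler_pXn2r// ?nnegrE ?addr_ge0 ?mulr_ge0 ?(ltW c0)// lerDr.
  have := ginf z z0 zR; have := le_normcD (g z + c%:C * z) (- (g z - eta%:C)).
  rewrite normcN; have -> : g z + c%:C * z - (g z - eta%:C) = eta%:C + c%:C * z by ring.
  have : c * R0 <= c * normc z by rewrite ler_pM2l.
  by move: ez; lra.
have d1 : 0 < 3 / 4 * c * R0 by rewrite !mulr_gt0// ?invr_gt0.
pose half := [set z : R[i] | normc z <= R0] `&` [set z | 0 <= complex.Re z].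
have clRe (f : R[i] -> R[i]) : continuous f -> closed [set z | 0 <= complex.Re (f z)].
  move=> fc.
  apply: (@closed_preimage_real _ (fun z => complex.Re (f z)) [set y | 0 <= y]).
    by move=> z; apply: continuous_comp; [exact: fc|exact: Re_continuous].
  exact: closed_ge.
have half_c : compact half.
  apply: compact_closedI; first exact: compact_disk.
  by apply: (clRe id) => z; exact: cvg_id.
move=> z0 eta0 Rez0 eta0_ge0 gz0.
pose A := half `&` ([set z | 0 <= complex.Re (g z)] `&` [set z | complex.Im (g z) = 0]).
have A_c : compact A.
  apply: compact_closedI => //; apply: closedI; first exact: clRe.
  apply: (@closed_preimage_real _ (fun z => complex.Im (g z)) [set 0]).
    by move=> z; apply: continuous_comp; [exact: gc|exact: Im_continuous].
  exact: closed_eq.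
have inA z eta : 0 <= complex.Re z -> 0 <= eta -> g z = eta%:C -> A z.
  move=> Rez eta_ge0 gz; split; last by rewrite /= gz.
  split => //=; rewrite leNgt; apply/negP => /ltW zR.
  by have := far _ _ Rez zR eta_ge0; rewrite gz subrr normc0 leNgt d1.
have [||z1 /set_mem z1A max1] :=
    @compact_EVT_max _ R (fun z => complex.Re (g z)) _ _ A_c.
- by exists z0; exact: inA gz0.
- apply: continuous_subspaceT => z.
  by apply: continuous_comp; [exact: gc|exact: Re_continuous].
have [[_ /= Rez1] [/= Reg1 Img1]] := z1A.
pose eta1 := complex.Re (g z1).
have gz1 : g z1 = eta1%:C by rewrite [g z1]complexE Img1 mulr0 addr0.
have dist_c eta : continuous (fun z => normc (g z - eta)).
  move=> z.
  apply: (@continuous_comp _ _ _ g (fun w => normc (w - eta))); first exact: gc.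
  exact: dist_continuous.
(* Inside the half-plane, Re z <= 0 describes the imaginary axis. *)
have axis_c : compact (half `&` [set z | complex.Re z <= 0]).
  apply: compact_closedI => //.
  apply: (@closed_preimage_real _ (@complex.Re R) [set y | y <= 0]).
    exact: Re_continuous.
  exact: closed_le.
have Re0 z : 0 <= complex.Re z -> complex.Re z <= 0 -> z = (complex.Im z)*i.
  by case: z => a b /= a0 a0'; congr Complex; apply/le_anti/andP.
have [||z2 /set_mem z2A min2] :=
    @compact_EVT_min _ R (fun z => normc (g z - eta1%:C)) _ _ axis_c.
- have n0R : normc (0 : R[i]) <= R0 by rewrite normc0 ltW.
  exists 0; split; last exact: lexx.
  by split; [exact: n0R|exact: lexx].
- exact/continuous_subspaceT/dist_c.
have [[_ /= Rez2] /= Rez2'] := z2A.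
pose d2 := normc (g z2 - eta1%:C).
have d20 : 0 < d2.
  rewrite lt_neqAle normc_ge0 andbT eq_sym; apply/eqP => /eq0_normc/eqP.
  by rewrite subr_eq0 (Re0 _ Rez2 Rez2') => /eqP; exact: gbd.
pose e := Num.min (3 / 4 * c * R0) d2 / 4.
have e0 : 0 < e by rewrite divr_gt0// lt_min d1.
have ed1 : e < 3 / 4 * c * R0.
  have : Num.min (3 / 4 * c * R0) d2 <= 3 / 4 * c * R0 by rewrite ge_min lexx.
  by move: e0; rewrite /e; lra.
have ed2 : 2 * e < d2.
  have : Num.min (3 / 4 * c * R0) d2 <= d2 by rewrite ge_min lexx orbT.
  by move: e0; rewrite /e; lra.
(* As e < d2 / 2, eta is still farther than e from g on the axis. *)
pose eta := eta1 + e.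
have eta_ge0 : 0 <= eta by rewrite addr_ge0// ltW.
pose u z := normc (g z - eta%:C).
have uz1 : u z1 = e.
  rewrite /u gz1; have -> : eta1%:C - eta%:C = (- e)%:C.
    by rewrite /eta rmorphD rmorphN/=; ring.
  by rewrite normc_real normrN gtr0_norm.
have half1 : half z1 by have [] := inA _ _ Rez1 Reg1 gz1.
have [||z3 /set_mem half3 min3] := @compact_EVT_min _ R u half _ half_c.
- by exists z1.
- exact/continuous_subspaceT/dist_c.
have u3e : u z3 <= e by rewrite -uz1 min3// inE.
have min3' z : 0 <= complex.Re z -> u z3 <= u z.
  move=> Rez; have [zR|/ltW zR] := leP (normc z) R0; first by rewrite min3// inE.
  by rewrite (le_trans u3e)// (le_trans (ltW ed1)) ?far.
have pos z : 0 <= complex.Re z -> u z <= e -> 0 < complex.Re z /\ normc z < R0.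
  move=> Rez ue; have zR : normc z < R0.
    rewrite ltNge; apply/negP => zR; have := far _ _ Rez zR eta_ge0.
    by rewrite leNgt (le_lt_trans ue).
  split => //; rewrite lt_neqAle Rez andbT eq_sym; apply/eqP => Rez'.
  have /min2 : z \in half `&` [set z | complex.Re z <= 0].
    rewrite inE; split; first by split => //=; exact: ltW.
    by case: z Rez' {Rez ue zR} => a b /= ->.
  rewrite -/d2; have -> : g z - eta1%:C = (g z - eta%:C) + e%:C.
    by rewrite /eta rmorphD/=; ring.
  have := le_normcD (g z - eta%:C) e%:C; rewrite normc_real (gtr0_norm e0) -/(u z).
  by move: ue ed2; lra.
have u3 z : 0 <= complex.Re z -> g z <> eta%:C.
  move=> Rez gz; have zA := inA _ _ Rez eta_ge0 gz.
  have := max1 _ (mem_set zA); rewrite /= gz /= -/eta1 /eta; move: e0; lra.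
(* The rightmost minimiser cannot have a neighbourhood of minimisers. *)
pose B := half `&` [set z | u z <= u z3].
have B_c : compact B.
  apply: compact_closedI => //.
  apply: (@closed_preimage_real _ u [set y | y <= u z3]); last exact: closed_le.
  exact: dist_c.
have [||z4 /set_mem z4B max4] :=
    @compact_EVT_max _ R (@complex.Re R) _ _ B_c.
- by exists z3; split => /=.
- exact/continuous_subspaceT/Re_continuous.
have [[/= _ Rez4] /= u4] := z4B.
have [Rez4_gt0 z4R] := pos _ Rez4 (le_trans u4 u3e).
have [[r r0 gr]|Hdec] := gopen z4 eta%:C Rez4_gt0 (u3 _ Rez4).
  pose h : R[i] := (r / 2)%:C.
  have r2 : 0 < r / 2 by rewrite divr_gt0.
  have hr : normc h < r by rewrite normc_real gtr0_norm//; move: r0; lra.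
  have Reh : complex.Re (z4 + h) = complex.Re z4 + r / 2 by case: (z4).
  have Reh0 : 0 <= complex.Re (z4 + h) by rewrite Reh addr_ge0// ltW.
  have uh : u (z4 + h) <= u z3 by rewrite /u gr.
  have [_ hR] := pos _ Reh0 (le_trans uh u3e).
  have /max4 : z4 + h \in B by rewrite inE; split => //; split => //=; exact: ltW.
  by rewrite Reh; move: r2; lra.
have [h hz uh] := Hdec _ Rez4_gt0.
have Reh : 0 <= complex.Re (z4 + h).
  have := Re_le_normc h; rewrite ler_norml => /andP[+ _].
  have -> : complex.Re (z4 + h) = complex.Re z4 + complex.Re h by case: (z4); case: (h).
  by move: hz; lra.
have := min3' _ Reh; rewrite leNgt => /negP; apply.
exact: lt_le_trans uh u4.
Qed.

End HalfPlane.

(** * Homogeneity, growth and values of eta_hat *)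

Section SquaredNorm.
Context {R : realType}.

Lemma sqnormZ (k : nat) (c : R) (x : 'rV[R]_k) : sqnorm (c *: x) = c ^+ 2 * sqnorm x.
Proof.
rewrite /sqnorm mulr_sumr; apply: eq_bigr => i _; rewrite mulr_sumr.
by apply: eq_bigr => j _; rewrite mxE exprMn.
Qed.

Lemma sqnorm_ge0 (k : nat) (x : 'rV[R]_k) : 0 <= sqnorm x.
Proof.
by rewrite sumr_ge0// => i _; rewrite sumr_ge0// => j _; rewrite sqr_ge0.
Qed.

Lemma sqnorm_eq0 (k : nat) (x : 'rV[R]_k) : sqnorm x = 0 -> x = 0.
Proof.
rewrite /sqnorm big_ord1 => /eqP; rewrite psumr_eq0 => [/allP x0|j _];
  last exact: sqr_ge0.
apply/rowP => j; rewrite mxE; apply/eqP; rewrite -sqrf_eq0.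
by apply: x0; rewrite mem_index_enum.
Qed.

End SquaredNorm.

Section EtaHat.
Context {R : realType} {q n1 r : nat}.
Variables (sys : system R q n1 r) (Up Um S : 'cV[R]_(n1 + r)).
Variables (Rp : 'M[R]_(n1 + r, (n1 + r).-1))
  (Rc : 'rV[R]_q -> R[i] -> 'M[R[i]]_(n1 + r, (n1 + r).-1)).
Hypotheses (n_gt0 : (0 < n1 + r)%N) (Rc_basis : unstable_frame sys Up Rc).
Hypothesis D_neq0 : forall (xi : 'rV[R]_q) (lam : R[i]),
  closed_half_space (xi, lam) -> eta_denominator sys Um S Rc xi lam <> 0.
Local Notation eta := (eta_hat sys Up Um S Rc).
Local Notation D := (eta_denominator sys Um S Rc).
Local Notation Delta := (Delta sys Up Um Rc).

Lemma Delta_hatE (xi : 'rV[R]_q) lam e :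
  Delta_hat sys Up Um S Rc xi lam e = Delta xi lam + e%:C * D xi lam.
Proof.
by rewrite /Delta_hat -[front _ _ _ _ _]scale1r det_augment_linear// mul1r.
Qed.

Lemma Delta_hat_eq0 (xi : 'rV[R]_q) lam e : closed_half_space (xi, lam) ->
  Delta_hat sys Up Um S Rc xi lam e = 0 <-> eta xi lam = e%:C.
Proof.
move=> /D_neq0/eqP d0; rewrite Delta_hatE /eta_hat; split=> [/eqP|<-].
  by rewrite addr_eq0 => /eqP ->; rewrite mulNr opprK mulfK.
by rewrite mulNr divfK// subrr.
Qed.

(** The factor t of a change of basis cancels in eta_hat; it is nonzero because
    the denominator is. *)
Lemma eta_ratio (xi : 'rV[R]_q) (lam t a b : R[i]) :
  closed_half_space (xi, lam) ->
  Delta xi lam = t * a -> D xi lam = t * b -> eta xi lam = - (a / b).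
Proof.
move=> /D_neq0/eqP + Da Db; rewrite /eta_hat Da Db mulf_eq0 negb_or => /andP[t0 b0].
by rewrite -mulf_div divff// mul1r.
Qed.

Lemma Aplus_scale (c : R) (xi : 'rV[R]_q) lam :
  Aplus sys Up (c *: xi) (c%:C * lam) = c%:C *: Aplus sys Up xi lam.
Proof.
rewrite /Aplus scalemxAl scalerDr scale_scalar_mx scaler_sumr; congr (_ *m _).
congr (_ + _); apply: eq_bigr => j _; rewrite scalerA mxE rmorphM/=.
by congr (_ *: _); ring.
Qed.

Lemma Aplus_conj (xi : 'rV[R]_q) lam :
  Aplus sys Up (- xi) (conjc lam) = map_mx conjc (Aplus sys Up xi lam).
Proof.
rewrite /Aplus map_mxM map_invmx map_conj_cplx map_mxD map_scalar_mx raddf_sum.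
congr (_ *m _).
congr (_ + _); apply: eq_bigr => j _; rewrite /= map_mxZ map_conj_cplx mxE.
congr (_ *: _); rewrite rmorphM/= rmorphN.
by apply/eqP; rewrite eq_complex/=; apply/andP; split; apply/eqP; ring.
Qed.

Lemma front_scale (c : R) (xi : 'rV[R]_q) lam :
  front sys Up Um (c *: xi) (c%:C * lam) = c%:C *: front sys Up Um xi lam.
Proof.
rewrite /front scalerDr scalerA scaler_sumr; congr (_ + _).
apply: eq_bigr => j _; rewrite scalerA mxE rmorphM/=.
by congr (_ *: _); ring.
Qed.

Lemma front_conj (xi : 'rV[R]_q) lam :
  front sys Up Um (- xi) (conjc lam) = map_mx conjc (front sys Up Um xi lam).
Proof.
rewrite /front map_mxD map_mxZ map_conj_cplx raddf_sum; congr (_ + _).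
apply: eq_bigr => j _; rewrite /= map_mxZ map_conj_cplx mxE.
congr (_ *: _); rewrite rmorphM/= rmorphN.
by apply/eqP; rewrite eq_complex/=; apply/andP; split; apply/eqP; ring.
Qed.

(** Aplus (c xi) (c lam) = c Aplus xi lam has the same unstable subspace as
    Aplus xi lam. *)
Lemma eta_scale_open (c : R) (xi : 'rV[R]_q) lam : 0 < c -> 0 < complex.Re lam ->
  eta (c *: xi) (c%:C * lam) = c%:C * eta xi lam.
Proof.
move=> c0 l0; have cl0 : 0 < complex.Re (c%:C * lam) by rewrite Re_scale mulr_gt0.
have [bas _ _ _] := Rc_basis.
have [t tP] : exists t, forall v : 'cV_(n1 + r),
    \det (augment (Rc (c *: xi) (c%:C * lam)) v) = t * \det (augment (Rc xi lam) v).
  apply: det_augment_basis n_gt0 _.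
  apply: unstable_basis_sub (bas _ _ cl0) (bas _ _ l0) => a a0.
  exists (c^-1%:C * a); split; first by rewrite Re_scale mulr_gt0 ?invr_gt0.
  have ci0 : c^-1%:C != 0 :> R[i] by rewrite fmorph_eq0 invr_eq0 gt_eqF.
  have -> : (Aplus sys Up xi lam)^T =
      c^-1%:C *: (Aplus sys Up (c *: xi) (c%:C * lam))^T.
    by rewrite Aplus_scale linearZ/= scalerA -rmorphM/= mulVf ?gt_eqF// scale1r.
  exact: geigenspace_scale.
rewrite (eta_ratio (right_half_closed _ cl0)
  (t := t) (a := c%:C * Delta xi lam) (b := D xi lam)).
- by rewrite /eta_hat mulrN mulrA.
- by rewrite /Defs.Delta tP front_scale det_augmentZ.
- exact: tP.
Qed.

Lemma eta_conj_open (xi : 'rV[R]_q) lam : 0 < complex.Re lam ->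
  eta (- xi) (conjc lam) = conjc (eta xi lam).
Proof.
move=> l0; have cl0 : 0 < complex.Re (conjc lam) by case: (lam) l0.
have [bas _ _ _] := Rc_basis.
have [t tP] : exists t, forall v : 'cV_(n1 + r),
    \det (augment (Rc (- xi) (conjc lam)) v) =
    t * \det (augment (map_mx conjc (Rc xi lam)) v).
  apply: det_augment_basis n_gt0 _.
  by apply: unstable_basis_conj (bas _ _ l0) _; rewrite -Aplus_conj; exact: bas.
have conj_det v : \det (augment (map_mx conjc (Rc xi lam)) (map_mx conjc v)) =
    conjc (\det (augment (Rc xi lam) v)) by rewrite -map_augment det_map_mx.
rewrite (eta_ratio (right_half_closed _ cl0)
  (t := t) (a := conjc (Delta xi lam)) (b := conjc (D xi lam))).
- by rewrite /eta_hat rmorphN fmorph_div.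
- by rewrite /Defs.Delta tP front_conj conj_det.
- by rewrite /eta_denominator tP -conj_det map_conj_cplx.
Qed.

Lemma Rc_entry_cvg p i j : closed_half_space p ->
  (fun p : 'rV[R]_q * R[i] => Rc p.1 p.2 i j) @ within closed_half_space (nbhs p)
    --> Rc p.1 p.2 i j.
Proof.
move=> Ap; have [_ _ _ /subspace_continuousP/(_ _ Ap) Rcp] := Rc_basis.
apply: (@cvg_comp _ _ _ (fun p : 'rV[R]_q * R[i] => Rc p.1 p.2)
  (fun M : 'M[R[i]]_(_, _) => M i j) _ (nbhs (Rc p.1 p.2))) => //.
exact: (@coord_continuous R[i]).
Qed.

Lemma augment_cvg (v : 'rV[R]_q -> R[i] -> 'cV[R[i]]_(n1 + r)) p :
  closed_half_space p ->
  (forall i, continuous (fun p : 'rV[R]_q * R[i] => v p.1 p.2 i 0)) ->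
  (fun p : 'rV[R]_q * R[i] => \det (augment (Rc p.1 p.2) (v p.1 p.2)))
    @ within closed_half_space (nbhs p) --> \det (augment (Rc p.1 p.2) (v p.1 p.2)).
Proof.
move=> Ap vc; apply: (@cvgC_det _ _ _ _ _ (fun p => augment _ _)) => i j.
under eq_fun do rewrite mxE; rewrite mxE; case: insub => [l|].
  exact: Rc_entry_cvg.
exact: cvg_within_filter (vc i p).
Qed.

Lemma pair1_entry_continuous j :
  continuous (fun p : 'rV[R]_q * R[i] => (p.1 0 j)%:C).
Proof.
move=> p; apply: (@continuous_comp _ _ _ (fun p : 'rV[R]_q * R[i] => p.1 0 j)
  (fun x : R => x%:C)); last exact: real_complex_continuous.
apply: (@continuous_comp _ _ _ fst (fun x : 'rV[R]_q => x 0 j)).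
  exact: cvg_fst.
exact: (@coord_continuous R).
Qed.

Lemma front_entry (xi : 'rV[R]_q) lam i : front sys Up Um xi lam i 0 =
  lam * cplx (jump Up Um id) i 0
  + \sum_j ('i * (xi 0 j)%:C) * cplx (jump Up Um (flux sys (lift ord0 j))) i 0.
Proof. by rewrite /front mxE summxE mxE; under eq_bigr do rewrite mxE. Qed.

Lemma front_continuous i :
  continuous (fun p : 'rV[R]_q * R[i] => front sys Up Um p.1 p.2 i 0).
Proof.
under eq_fun do rewrite front_entry.
move=> p; apply: (@cvgC_D _ _ _ _ (fun p => p.2 * _)).
  apply: (@cvgC_M _ _ _ _ snd (fun=> _)); first exact: cvg_snd.
  exact: cvg_cst.
apply: (@cvgC_sum _ _ _ _ _ _
  (fun (j : 'I_q) (p : 'rV[R]_q * R[i]) =>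
     'i * (p.1 0 j)%:C * cplx (jump Up Um (flux sys (lift ord0 j))) i 0)
  (fun j : 'I_q =>
     'i * (p.1 0 j)%:C * cplx (jump Up Um (flux sys (lift ord0 j))) i 0)) => j.
apply: (@cvgC_M _ _ _ _ (fun p : 'rV[R]_q * R[i] => 'i * (p.1 0 j)%:C) (fun=> _));
  last exact: cvg_cst.
apply: (@cvgC_M _ _ _ _ (fun=> 'i) _); first exact: cvg_cst.
exact: pair1_entry_continuous.
Qed.

Lemma eta_continuous :
  {within closed_half_space, continuous (fun p : 'rV[R]_q * R[i] => eta p.1 p.2)}.
Proof.
have -> : (fun p : 'rV[R]_q * R[i] => eta p.1 p.2) =
    (fun p => -1 * (Delta p.1 p.2 * (D p.1 p.2)^-1)).
  by apply/funext => p; rewrite mulN1r.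
apply/subspace_continuousP => p Ap.
apply: (@cvgC_M _ _ _ _ (fun=> -1)
  (fun p : 'rV[R]_q * R[i] => Delta p.1 p.2 * (D p.1 p.2)^-1)
  (-1) (Delta p.1 p.2 * (D p.1 p.2)^-1)); first exact: cvg_cst.
apply: (@cvgC_M _ _ _ _ (fun p : 'rV[R]_q * R[i] => Delta p.1 p.2)
  (fun p : 'rV[R]_q * R[i] => (D p.1 p.2)^-1) (Delta p.1 p.2) (D p.1 p.2)^-1).
  exact: (@augment_cvg (front sys Up Um) p Ap front_continuous).
apply: (@cvgV R[i] _ _ _ (fun p : 'rV[R]_q * R[i] => D p.1 p.2) (D p.1 p.2)).
  by apply/eqP/D_neq0; case: (p) Ap.
apply: (@augment_cvg (fun _ _ => cplx (dF1S sys Um S)) p Ap) => i.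
exact: cst_continuous.
Qed.

Lemma eta_scale (c : R) (xi : 'rV[R]_q) lam : 0 < c -> closed_half_space (xi, lam) ->
  eta (c *: xi) (c%:C * lam) = c%:C * eta xi lam.
Proof.
move=> c0; apply: (@eq_closed_half_space _ q (fun p => eta (c *: p.1) (c%:C * p.2))
  (fun p => c%:C * eta p.1 p.2) xi).
- apply: (@within_comp _ _ _ (fun p => eta p.1 p.2)
    (fun p : 'rV[R]_q * R[i] => (c *: p.1, c%:C * p.2)) _ _ eta_continuous).
    move=> p; apply: (@cvg_pair _ _ _ _ (nbhs (c *: p.1)) (nbhs (c%:C * p.2))).
      apply: (@continuous_comp _ _ _ fst (fun x : 'rV[R]_q => c *: x)).
        exact: cvg_fst.
      exact: scaler_continuous.
    apply: (@cvgC_M _ _ _ _ (fun=> c%:C) snd c%:C p.2); first exact: cvg_cst.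
    exact: cvg_snd.
  move=> p [p0 pn0]; split; first by rewrite /= Re_scale mulr_ge0// ltW.
  move=> [x0 l0]; apply: pn0; case: p {p0} x0 l0 => /= a b.
  move=> /eqP; rewrite scaler_eq0 gt_eqF//= => /eqP ->.
  by move=> /eqP; rewrite mulf_eq0 fmorph_eq0 gt_eqF//= => /eqP ->.
- apply/subspace_continuousP => p Ap.
  apply: (@cvgC_M _ _ _ _ (fun=> c%:C) (fun p : 'rV[R]_q * R[i] => eta p.1 p.2)
    c%:C (eta p.1 p.2)); first exact: cvg_cst.
  by have /subspace_continuousP := eta_continuous; exact.
- by move=> l l0; exact: eta_scale_open.
Qed.

Lemma eta_conj (xi : 'rV[R]_q) lam : closed_half_space (xi, lam) ->
  eta (- xi) (conjc lam) = conjc (eta xi lam).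
Proof.
apply: (@eq_closed_half_space _ q (fun p => eta (- p.1) (conjc p.2))
  (fun p => conjc (eta p.1 p.2)) xi).
- apply: (@within_comp _ _ _ (fun p => eta p.1 p.2)
    (fun p : 'rV[R]_q * R[i] => (- p.1, conjc p.2)) _ _ eta_continuous).
    move=> p; apply: (@cvg_pair _ _ _ _ (nbhs (- p.1)) (nbhs (conjc p.2))).
      apply: (@continuous_comp _ _ _ fst (fun x : 'rV[R]_q => - x)).
        exact: cvg_fst.
      exact: oppr_continuous.
    apply: (@continuous_comp _ _ _ snd (@conjc R)); first exact: cvg_snd.
    exact: conjc_continuous.
  move=> [a [x y]] [/= p0 pn0]; split => //= -[/eqP + x0 y0].
  rewrite oppr_eq0 => /eqP a0; apply: pn0; rewrite a0 x0; congr (_, Complex _ _).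
  by apply/eqP; rewrite -oppr_eq0 y0.
- apply/subspace_continuousP => p Ap.
  apply: (@cvg_comp _ _ _ (fun p => eta p.1 p.2) (@conjc R) _ (nbhs (eta p.1 p.2))).
    by have /subspace_continuousP := eta_continuous; exact.
  exact: conjc_continuous.
- by move=> l l0; exact: eta_conj_open.
Qed.

Hypotheses (Rp_basis : unstable_basis (cplx (dF sys Up ord0)) (cplx Rp))
  (real_ev : real_eigenvalues (dF sys Up ord0))
  (ev_neq0 : H5 sys Up)
  (one_dim : one_dim_stability sys Up Um S Rp)
  (nondegenerate : \det (augment Rp (jump Up Um id)) <> 0).

(** The positive number such that eta_hat 0 lam = - rate * lam. *)
Let rate : R := \det (augment Rp (jump Up Um id)) / \det (augment Rp (dF1S sys Um S)).

Lemma dF1_unit : cplx (dF sys Up ord0) \in unitmx.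
Proof.
rewrite -row_free_unit -kermx_eq0; apply/negPn/negP => nz.
have : eigenvalue (cplx (dF sys Up ord0)) 0.
  by rewrite /eigenvalue /eigenspace raddf0 subr0.
by move=> /ev_neq0; rewrite eqxx.
Qed.

(** At xi = 0 the matrix Aplus is lam dF1^-1.  As the eigenvalues b of dF1 are
    real, lam / b has positive real part exactly when b > 0: the unstable subspace
    is that of dF1. *)
Lemma det_Rc0 lam : 0 < complex.Re lam ->
  exists t, forall v : 'cV_(n1 + r),
    \det (augment (Rc 0 lam) v) = t * \det (augment (cplx Rp) v).
Proof.
move=> l0; have [bas _ _ _] := Rc_basis.
apply: det_augment_basis n_gt0 _.
apply: unstable_basis_sub (bas _ _ l0) Rp_basis => a a0.
set A := cplx _.
have -> : (Aplus sys Up 0 lam)^T = lam *: invmx A^T.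
  rewrite /Aplus big1 ?addr0 => [|j _]; last by rewrite mxE mulr0 scale0r.
  by rewrite mul_scalar_mx linearZ/= trmx_inv.
have an0 : a != 0 by apply: contraTneq a0 => ->; rewrite ltxx.
have Au : A^T \in unitmx by rewrite unitmx_tr dF1_unit.
have sub := geigenspace_inv lam Au an0.
have [ev|nev] := boolP (eigenvalue A^T (lam / a)); last first.
  exists 1; split; first exact: ltr01.
  by move: sub; rewrite (geigenspace_noneigen nev) => /submx_trans; apply; exact: sub0mx.
exists (lam / a); split => //.
have la : lam = (lam / a) * a by rewrite divfK.
have : complex.Im (lam / a) = 0 by apply: real_ev; rewrite -eigenvalue_trmx.
case: (lam / a) la => x y /= + y0; rewrite y0 => la.
move: l0; rewrite la; case: (a) a0 => b d /= b0.
by rewrite mul0r subr0 pmulr_lgt0.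
Qed.

Lemma rate_gt0 : 0 < rate.
Proof.
have d0 : \det (augment Rp (dF1S sys Um S)) <> 0.
  have l1 : 0 < complex.Re (1 : R[i]) by rewrite /= ltr01.
  have [t tP] := det_Rc0 l1.
  move=> e; apply: (D_neq0 (right_half_closed 0 l1)).
  rewrite /eta_denominator tP /cplx -map_augment.
  by rewrite (det_map_mx (real_complex R)) e rmorph0 mulr0.
move: one_dim; rewrite /one_dim_stability /rate.
set y := \det _ in d0 *; set x := \det _ => xy0.
have x0 : x != 0 by apply/eqP; exact: nondegenerate.
have y0 : y != 0 by apply/eqP.
have {}xy0 : 0 < x * y.
  by move: xy0; rewrite sgr_ge0 => xy0; rewrite lt_neqAle xy0 andbT eq_sym mulf_neq0.
rewrite -(pmulr_lgt0 _ (_ : 0 < y ^+ 2)); last by rewrite exprn_even_gt0.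
by rewrite expr2 mulrA divfK.
Qed.

Lemma eta_xi0 lam : closed_half_space ((0 : 'rV[R]_q), lam) ->
  eta 0 lam = - (rate%:C * lam).
Proof.
apply: (@eq_closed_half_space _ q (fun p => eta p.1 p.2) (fun p => - (rate%:C * p.2)) 0).
- exact: eta_continuous.
- apply: continuous_subspaceT => p.
  have -> : (fun p : 'rV[R]_q * R[i] => - (rate%:C * p.2)) = (fun p => (- rate%:C) * p.2).
    by apply/funext => p'; rewrite mulNr.
  apply: (@cvgC_M _ _ _ _ (fun=> - rate%:C) snd (- rate%:C) p.2); first exact: cvg_cst.
  exact: cvg_snd.
move=> l l0 /=; have [t tP] := det_Rc0 l0.
have detC (v : 'cV[R]_(n1 + r)) :
    \det (augment (cplx Rp) (cplx v)) = (\det (augment Rp v))%:C.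
  by rewrite /cplx -map_augment (det_map_mx (real_complex R)).
rewrite (eta_ratio (right_half_closed 0 l0) (t := t)
  (a := l * (\det (augment Rp (jump Up Um id)))%:C)
  (b := (\det (augment Rp (dF1S sys Um S)))%:C)).
- by rewrite /rate rmorphM fmorphV; ring.
- rewrite /Defs.Delta tP /front big1 ?addr0 ?det_augmentZ ?detC// => j _.
  by rewrite mxE mulr0 scale0r.
- by rewrite /eta_denominator tP detC.
Qed.

(** By homogeneity eta_hat omega lam = N * eta_hat (omega / N) (lam / N) with
    N = |lam|, and eta_hat is uniformly close to its values at xi = 0 on the
    compact half-circle |z| = 1, Re z >= 0. *)
Lemma eta_growth (omega : 'rV[R]_q) : exists2 R0 : R, 0 < R0 &
  forall lam, 0 <= complex.Re lam -> R0 <= normc lam ->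
    normc (eta omega lam + rate%:C * lam) <= rate / 4 * normc lam.
Proof.
have c00 := rate_gt0.
pose K := [set z : R[i] | normc z <= 1] `&`
  ([set z | 1 <= normc z] `&` [set z | 0 <= complex.Re z]).
have K_c : compact K.
  apply: compact_closedI; first exact: compact_disk.
  apply: closedI.
    apply: (@closed_preimage_real _ (@normc R) [set y | 1 <= y]).
      exact: normc_continuous.
    exact: closed_ge.
  apply: (@closed_preimage_real _ (@complex.Re R) [set y | 0 <= y]).
    exact: Re_continuous.
  exact: closed_ge.
have KA (x : 'rV[R]_q) z : K z -> closed_half_space (x, z).
  move=> [_ [/= z1 z0]]; split => // -[_ ze]; move: z1.
  by rewrite ze normc0 leNgt ltr01.
pose P (s : R) z := K z -> normc (eta (s *: omega) z + rate%:C * z) <= rate / 4.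
have near0 : \forall s \near (0 : R), K `<=` P s.
  apply: (iffLR (compact_near_coveringP K) K_c R (nbhs (0 : R)) P _) => z0 Kz0.
  (* Continuity at (0, z0), transported to the variables (z, s). *)
  pose h (p : R[i] * R) : 'rV[R]_q * R[i] := (p.2 *: omega, p.1).
  have hc : continuous h.
    move=> p; apply: (@cvg_pair _ _ _ _ (nbhs (p.2 *: omega)) (nbhs p.1)).
      apply: (@continuous_comp _ _ _ snd (fun s : R => s *: omega)).
        exact: cvg_snd.
      exact: scalel_continuous.
    exact: cvg_fst.
  have A0 := KA 0 z0 Kz0.
  have c8 : 0 < rate / 8 by rewrite divr_gt0.
  have /subspace_continuousP/(_ _ A0)/cvg_complexP/(_ _ c8) H := eta_continuous.
  have H' : \forall p \near ((0 : 'rV[R]_q), z0), closed_half_space p ->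
    normc (eta 0 z0 - eta p.1 p.2) < rate / 8 := H.
  have h0 : h (z0, 0) = (0, z0) by rewrite /h scale0r.
  have H2 : \forall p \near (z0, (0 : R)), closed_half_space (h p) ->
    normc (eta 0 z0 - eta (h p).1 (h p).2) < rate / 8.
    have H1 : nbhs (h (z0, 0)) [set p | closed_half_space p ->
      normc (eta 0 z0 - eta p.1 p.2) < rate / 8] by rewrite h0; exact: H'.
    exact: hc (z0, 0) _ H1.
  have H3 : \forall p \near (z0, (0 : R)), normc (z0 - p.1) < 1 / 8.
    have : (fst : R[i] * R -> R[i]) @ (z0, (0 : R)) --> z0 by exact: cvg_fst.
    by move=> /cvg_complexP; apply.
  apply: (@filterS _ _ (nbhs_filter (z0, (0 : R))) _ _ _ (filterI H2 H3)).
  move=> [z s] [/= hz dz] Kz.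
  have {}hz := hz (KA _ _ Kz); rewrite eta_xi0// in hz.
  have -> : eta (s *: omega) z + rate%:C * z =
      - (- (rate%:C * z0) - eta (s *: omega) z) - rate%:C * (z0 - z) by ring.
  apply: le_trans (le_normcD _ _) _; rewrite !normcN normcM normc_real (gtr0_norm c00).
  have : rate * normc (z0 - z) <= rate * (1 / 8) by rewrite ler_pM2l// ltW.
  by move: hz; lra.
have /nbhs_ballP[d /= d0 dK] := near0.
exists (2 / d); first by rewrite divr_gt0.
move=> lam l0 lR; pose N := normc lam.
have N0 : 0 < N by apply: lt_le_trans lR; rewrite divr_gt0.
have sd : `|N^-1| < d.
  rewrite gtr0_norm ?invr_gt0// -div1r ltr_pdivrMr//.
  by move: lR; rewrite ler_pdivrMr// mulrC -/N; lra.
have Kz : K ((N^-1)%:C * lam).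
  have nz1 : normc ((N^-1)%:C * lam) = 1.
    by rewrite normcM normc_real gtr0_norm ?invr_gt0// mulVf// gt_eqF.
  split; first by rewrite /= nz1.
  by split; rewrite /= ?nz1// Re_scale mulr_ge0// invr_ge0 ltW.
have := dK N^-1 _ _ Kz Kz.
rewrite /ball/= sub0r normrN => /(_ sd) H.
have NN : N * N^-1 = 1 by rewrite divff ?gt_eqF.
have omE : N *: (N^-1 *: omega) = omega by rewrite scalerA NN scale1r.
have lamE : N%:C * ((N^-1)%:C * lam) = lam by rewrite mulrA -rmorphM NN mul1r.
have := eta_scale N0 (KA (N^-1 *: omega) _ Kz); rewrite omE lamE => ->.
have -> : rate%:C * lam = N%:C * (rate%:C * ((N^-1)%:C * lam)).
  by rewrite (mulrCA N%:C) lamE.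
rewrite -mulrDr.
by rewrite normcM normc_real (gtr0_norm N0) -/N mulrC ler_pM2r.
Qed.

Lemma germ_augment (xi : 'rV[R]_q) z (v : R[i] -> 'cV[R[i]]_(n1 + r)) :
  0 < complex.Re z -> (forall i, germ (fun h => v h i 0)) ->
  germ (fun h => \det (augment (Rc xi (z + h)) (v h))).
Proof.
move=> z0 gv; apply: germ_det => i j; under eq_fun do rewrite mxE.
case: insub => [l|]; last exact: gv.
by have [_ _ an _] := Rc_basis; apply: (analytic_germ (an xi z i l z0)).
Qed.

(** For w complex, eta_hat - w is the quotient of the analytic functions
    - Delta - w D and D of lam, to which the minimum modulus principle applies. *)
Lemma eta_avoid_half_plane (omega : 'rV[R]_q) : omega <> 0 ->
  (forall tau e : R, 0 <= e -> eta omega (tau *i) <> e%:C) ->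
  forall lam (e : R), 0 <= complex.Re lam -> 0 <= e -> eta omega lam <> e%:C.
Proof.
move=> om0 axis lam e lam0 e0.
have [R0 R00 growth] := eta_growth omega.
pose g z := eta omega (clamp z).
have gE z : 0 <= complex.Re z -> g z = eta omega z by move=> z0; rewrite /g clamp_id.
have inA z : 0 <= complex.Re z -> closed_half_space (omega, z).
  by move=> z0; split => // -[].
rewrite -gE//.
apply: (@half_plane_avoid R g rate R0 _ _ R00 _ _ _ lam e lam0 e0).
- apply/continuous_subspace_setT.
  apply: (@within_comp _ _ _ (fun p => eta p.1 p.2)
    (fun z : R[i] => (omega, clamp z)) _ _ eta_continuous).
    move=> z; apply: (@cvg_pair _ _ _ (nbhs z) (nbhs omega) (nbhs (clamp z))
      (nbhs_filter z)); first exact: cvg_cst.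
    exact: clamp_continuous.
  by move=> z _; apply: inA; rewrite /= le_max lexx orbT.
- exact: rate_gt0.
- by move=> z z0 zR; rewrite gE//; exact: growth.
- by move=> tau e' e'0; rewrite gE//; exact: axis.
move=> z w z0; rewrite (gE z (ltW z0)) => gzw.
have Dz h : normc h < complex.Re z -> 0 <= complex.Re (z + h).
  move=> hz; have := Re_le_normc h; rewrite ler_norml => /andP[+ _].
  have -> : complex.Re (z + h) = complex.Re z + complex.Re h by case: (z); case: (h).
  by move: hz; lra.
(* The frame is analytic only near points of the open half-plane, hence the
   restrictions |h| < Re z below. *)
pose phi h := -1 * Delta omega (z + h) + (- w) * D omega (z + h).
pose d h := D omega (z + h).
have gd : germ d by apply: germ_augment => // i; exact: germ_cst.
have gphi : germ phi.
  apply: germD; apply: germM; [exact: germ_cst| |exact: germ_cst|exact: gd].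
  apply: germ_augment => // i; under eq_fun do rewrite front_entry.
  apply: germD; last exact: germ_cst.
  apply: germM; last exact: germ_cst.
  by apply: germD; [exact: germ_cst|exact: germ_id].
have d_neq0 h : normc h < complex.Re z -> d h != 0.
  by move=> hz; apply/eqP/D_neq0/inA/Dz.
have gphid h : normc h < complex.Re z -> g (z + h) - w = phi h / d h.
  move=> hz; have dh := d_neq0 h hz; rewrite gE ?Dz// /eta_hat /phi -/(d h).
  by field.
have n00 : normc (0 : R[i]) < complex.Re z by rewrite normc0.
have d0 := d_neq0 0 n00.
have gphid0 : g z - w = phi 0 / d 0 by have := gphid 0 n00; rewrite addr0.
have phi0 : phi 0 != 0.
  apply/eqP => p0; apply: gzw; apply/eqP; rewrite -subr_eq0 -gE ?(ltW z0)//.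
  by rewrite gphid0 p0 mul0r.
have [[e1 e10 const]|decr] := quotient_argand gphi gd phi0 d0.
  left; exists (Num.min e1 (complex.Re z)); first by rewrite lt_min e10.
  move=> h; rewrite lt_min => /andP[he hz].
  rewrite -(gE z (ltW z0)); apply: (addIr (- w)); rewrite (gphid h hz) gphid0.
  apply/eqP; rewrite (eqr_div _ _ (d_neq0 h hz) d0); apply/eqP; exact: const.
right=> e1 e10.
have m0 : 0 < Num.min e1 (complex.Re z) by rewrite lt_min e10.
have [h + hlt] := decr _ m0; rewrite lt_min => /andP[he hz]; exists h => //.
have dpos h' : normc h' < complex.Re z -> 0 < normc (d h').
  move=> h'z; rewrite lt_neqAle normc_ge0 andbT eq_sym.
  by apply: contra (d_neq0 h' h'z) => /eqP/eq0_normc ->.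
rewrite -(gE z (ltW z0)) (gphid h hz) gphid0 !normcM !normcV ltr_pdivrMr ?dpos//.
by rewrite mulrAC ltr_pdivlMr ?dpos.
Qed.

(** Where xi is nonzero, homogeneity reduces to |xi| = 1; where xi = 0, the
    value - rate * lam is nonnegative real only at lam = 0. *)
Lemma nonvanishing_iff_sphere :
  nonvanishing_on_half_sphere sys Up Um S Rc <->
  (forall omega : 'rV[R]_q, sqnorm omega = 1 ->
     eta_image sys Up Um S Rc omega `&` nonneg_real_axis = set0).
Proof.
split=> [nv omega om1|avoid xi lam e sphere lam0 e0 nz].
  apply/seteqP; split => // _ [[tau _ <-] [e /= e0 ee]].
  have om0 : omega <> 0.
    move=> om; move: om1; rewrite om -(scale0r 0) sqnormZ expr0n mul0r => /eqP.
    by rewrite eq_sym oner_eq0.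
  have N0 : 0 < 1 + tau ^+ 2 + e ^+ 2.
    by rewrite -addrA ltr_pwDl// addr_ge0// sqr_ge0.
  pose c := (Num.sqrt (1 + tau ^+ 2 + e ^+ 2))^-1.
  have c_gt0 : 0 < c by rewrite invr_gt0 sqrtr_gt0.
  have c2 : c ^+ 2 * (1 + tau ^+ 2 + e ^+ 2) = 1.
    by rewrite exprVn sqr_sqrtr ?(ltW N0)// mulVf// gt_eqF.
  have A0 : closed_half_space (omega, tau *i) by split => // -[].
  have Ac : closed_half_space (c *: omega, c%:C * tau *i).
    split; first by rewrite Re_scale mulr0.
    by move=> [/eqP]; rewrite scaler_eq0 gt_eqF//= => /eqP.
  apply: (nv (c *: omega) (c%:C * tau *i) (c * e)).
  - by rewrite sqnormZ om1 /= -[RHS]c2; ring.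
  - by case: Ac.
  - by rewrite mulr_ge0// ltW.
  - by case: Ac.
  - by apply/(Delta_hat_eq0 _ Ac); rewrite eta_scale// -ee rmorphM.
have A : closed_half_space (xi, lam) by [].
move/(Delta_hat_eq0 _ A) => etaE.
have [xi0|xi0] := eqVneq xi 0.
  move: A etaE nz; rewrite xi0 => A; rewrite eta_xi0// => etaE; apply.
  have c00 := rate_gt0; congr pair; move: lam0 etaE; case: (lam) => a b /= a0 [aE /eqP].
  rewrite !mul0r addr0 oppr_eq0 mulf_eq0 gt_eqF//= => /eqP ->.
  congr Complex; apply/eqP; rewrite eq_le a0 andbT.
  by rewrite -(pmulr_rle0 _ c00) -oppr_ge0; move: aE; rewrite mul0r subr0 => ->.
have N20 : 0 < sqnorm xi.
  rewrite lt_neqAle sqnorm_ge0 andbT eq_sym; apply: contra xi0 => /eqP/sqnorm_eq0.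
  by move=> ->.
pose c := (Num.sqrt (sqnorm xi))^-1.
have c_gt0 : 0 < c by rewrite invr_gt0 sqrtr_gt0.
have om1 : sqnorm (c *: xi) = 1.
  by rewrite sqnormZ exprVn sqr_sqrtr ?(ltW N20)// mulVf// gt_eqF.
have om0 : c *: xi <> 0.
  by apply/eqP; rewrite scaler_eq0 gt_eqF.
apply: (eta_avoid_half_plane om0 _ (lam := c%:C * lam) (e := c * e)).
- move=> tau e' e'0 ee.
  have : (eta_image sys Up Um S Rc (c *: xi) `&` nonneg_real_axis) e'%:C.
    by split; [exists tau|exists e'].
  by rewrite (avoid _ om1).
- by rewrite Re_scale mulr_ge0// ltW.
- by rewrite mulr_ge0// ltW.
- by rewrite eta_scale// etaE rmorphM.
Qed.

(** By conjugation eta_hat (- omega) (i tau) is the conjugate of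
    eta_hat omega (- i tau), and a real number is its own conjugate. *)
Lemma eta_image_opp (omega : 'rV[R]_q) : omega <> 0 ->
  eta_image sys Up Um S Rc omega `&` nonneg_real_axis = set0 ->
  eta_image sys Up Um S Rc (- omega) `&` nonneg_real_axis = set0.
Proof.
move=> om0 avoid; apply/seteqP; split => // _ [[tau _ <-] [e /= e0 ee]].
have A0 : closed_half_space (omega, (- tau) *i) by split => // -[].
have : (eta_image sys Up Um S Rc omega `&` nonneg_real_axis) e%:C.
  split; last by exists e.
  exists (- tau) => //; apply: (can_inj (@conjcK R)).
  rewrite -(eta_conj A0)/= /conjc/= opprK oppr0.
  by rewrite -ee.
by rewrite avoid.
Qed.

(** The unit sphere of the line is {1, -1}. *)
Lemma nonvanishing_iff_line : q = 1%N ->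
  (nonvanishing_on_half_sphere sys Up Um S Rc <->
   eta_image sys Up Um S Rc (const_mx 1) `&` nonneg_real_axis = set0).
Proof.
move=> q1.
have lt1 (k : 'I_q) : k = 0 :> nat.
  by case: k => k /=; rewrite q1 ltnS leqn0 => /eqP.
have sq (x : 'rV[R]_q) j : sqnorm x = x 0 j ^+ 2.
  rewrite /sqnorm big_ord1 (bigD1 j)//= big1 ?addr0// => k /eqP kj.
  by case: kj; apply/val_inj; rewrite /= !lt1.
have q0 : (0 < q)%N by rewrite q1.
have one1 : sqnorm (const_mx 1 : 'rV[R]_q) = 1.
  by rewrite (sq _ (Ordinal q0)) mxE expr1n.
have one0 : (const_mx 1 : 'rV[R]_q) <> 0.
  by move=> /rowP/(_ (Ordinal q0))/eqP; rewrite !mxE oner_eq0.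
rewrite nonvanishing_iff_sphere; split=> [avoid|avoid omega om1]; first exact: avoid.
have : forall j, omega 0 j = omega 0 (Ordinal q0).
  by move=> j; congr (omega 0 _); apply/val_inj; rewrite /= lt1.
move: om1; rewrite (sq _ (Ordinal q0)) => /eqP; rewrite sqrf_eq1 => /orP[]/eqP -> om.
  by rewrite (_ : omega = const_mx 1)//; apply/rowP => j; rewrite om mxE.
rewrite (_ : omega = - const_mx 1); last by apply/rowP => j; rewrite om !mxE.
exact: eta_image_opp.
Qed.

End EtaHat.

Lemma symbol_conormal1 (R : realType) d n (A : 'I_d.+1 -> 'M[R]_n) :
  symbol A conormal1 = A ord0.
Proof.
rewrite /symbol (bigD1 ord0)//= big1 => [|j j0]; last first.
  by rewrite mxE eqxx (negbTE j0) scale0r.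
by rewrite mxE !eqxx scale1r addr0.
Qed.

Lemma conormal1_neq0 (R : realType) d : (conormal1 : 'rV[R]_d.+1) <> 0.
Proof. by move=> /rowP/(_ ord0)/eqP; rewrite !mxE !eqxx oner_eq0. Qed.

Theorem proposition1p19 (R : realType) (q n1 r : nat) (sys : system R q n1 r)
    (s : nat) (theta theta1 : R) (Up Um : 'cV[R]_(n1 + r))
    (Uh : R -> 'cV[R]_(n1 + r)) (S : 'cV[R]_(n1 + r))
    (Rp : 'M[R]_(n1 + r, (n1 + r).-1))
    (Rc : 'rV[R]_q -> R[i] -> 'M[R[i]]_(n1 + r, (n1 + r).-1))
    (q_gt0 : (0 < q)%N) (n_gt0 : (0 < n1 + r)%N)
    (shock : standing_lax1_shock sys s theta theta1 Up Um Uh)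
    (S_def : is_departure_direction Uh S)
    (Rp_basis : unstable_basis (cplx (dF sys Up ord0)) (cplx Rp))
    (Rc_basis : unstable_frame sys Up Rc)
    (eta_hat_defined : forall (xi : 'rV[R]_q) (lam : R[i]),
       closed_half_space (xi, lam) -> eta_denominator sys Um S Rc xi lam <> 0)
    (one_dim : one_dim_stability sys Up Um S Rp)
    (nondegenerate : \det (augment Rp (jump Up Um id)) <> 0) :
  (nonvanishing_on_half_sphere sys Up Um S Rc <->
   (forall omega : 'rV[R]_q, sqnorm omega = 1 ->
      eta_image sys Up Um S Rc omega `&` nonneg_real_axis = set0)) /\
  (q = 1%N ->
   (nonvanishing_on_half_sphere sys Up Um S Rc <->
    eta_image sys Up Um S Rc (const_mx 1) `&` nonneg_real_axis = set0)).
Proof.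
have [_ _ _ _ [h4 [h5 _] _ _]] := shock.
have real_ev : real_eigenvalues (dF sys Up ord0).
  rewrite -symbol_conormal1.
  by case: h4 => [[h _]|[_ _ h _]]; have [[]] := h _ (@conormal1_neq0 R q).
split; first exact: nonvanishing_iff_sphere one_dim nondegenerate.
exact: nonvanishing_iff_line one_dim nondegenerate.
Qed.
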